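(* Let $w$ be a permutation avoiding the pattern $1423$. Then $c_w(\beta)=d_w(\beta)$; that is, $c_w(\beta)=\sum_{P\in\mathrm{CMRPD}(w)}\beta^{\mathrm{mbt}(P)}$. Moreover $\Upsilon_w(\beta)=\sum_{v\le w}d_{\mathrm{perm}(v)}(\beta)$, the sum over all subwords $v$ of $w$.
   Context: $\Upsilon_w(\beta)=\mathfrak{G}^{(\beta)}_w(1,\dots,1)$, where $\mathfrak{G}^{(\beta)}_w$ is the $\beta$-Grothendieck polynomial ($\mathfrak{G}^{(\beta)}_{w_0}=x_1^{n-1}\cdots x_{n-1}$ for $w_0=n\cdots21$; $\mathfrak{G}^{(\beta)}_w=\partial_i((1+\beta x_{i+1})\mathfrak{G}^{(\beta)}_{ws_i})$ when $w(i)<w(i+1)$, $\partial_if=(f-s_if)/(x_i-x_{i+1})$); $\Upsilon_\emptyset=1$. $c_w(\beta)=\sum_{\emptyset\le v\le w}(-1)^{|w|-|v|}\Upsilon_{\mathrm{perm}(v)}(\beta)$ over all subwords $v$ of $w$, $\mathrm{perm}(v)$ being the permutation order-isomorphic to $v$. For a permutation $\sigma\in S_m$: a pipe dream fills the staircase $\{(i,k):i+k\le m+1\}$ (row $i$ from top, column $k$ from left) with crossing tiles and bumping tiles (upper-left arc joining top/left edges, lower-right arc joining bottom/right edges), tiles $(i,m+1-i)$ being bumping; pipe $k$ enters at the top of column $k$, travels down/left to the left boundary. Reduced for $\sigma$: two pipes cross at most once and the pipe exiting row $i$ is $\sigma(i)$. A marked reduced pipe dream also marks some bumping tiles, a bumping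 tile in row $i$ being markable only if its two pipes cross at a crossing in a row strictly above $i$; $\mathrm{MRPD}(\sigma)$, $\mathrm{mbt}(P)$ = number of marked tiles. Pipe $j$ is removable if (i) column $j$ consists of crossings all traversed by pipe $j$ followed only by unmarked bumping tiles; (ii) for each crossing traversed by pipe $j$ the tile directly above (if any) is not an unmarked bumping tile; (iii) pipe $j$ traverses no marked bumping tile. $P$ is core if it has no removable pipe; $\mathrm{CMRPD}(\sigma)$ is the set of core elements and $d_\sigma(\beta)=\sum_{P\in\mathrm{CMRPD}(\sigma)}\beta^{\mathrm{mbt}(P)}$, $d_\emptyset=1$. *)

(* Defs.v *)
From HB Require Import structures.
From mathcomp Require Import all_boot all_order all_algebra.
From mathcomp Require Import fingroup perm.
From mathcomp Require Import mpoly.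
From Stdlib Require Import ClassicalEpsilon.

Set Implicit Arguments.
Unset Strict Implicit.
Unset Printing Implicit Defensive.

Import Order.TTheory GRing.Theory Num.Theory.
Local Open Scope ring_scope.

Definition is_perm (w : seq nat) : bool := perm_eq w (iota 1 (size w)).

(* perm(v): the permutation order-isomorphic to the word v (entries are
   replaced by their rank, 1-based). *)
Definition std (v : seq nat) : seq nat :=
  [seq count (fun y => (y <= x)%N) v | x <- v].

Definition contains_pattern (w p : seq nat) : Prop :=
  exists t : (size w).-tuple bool, std (mask t w) = p.

Definition avoids (w p : seq nat) : Prop := ~ contains_pattern w p.

(* beta-Grothendieck polynomials.  Coefficient ring: Z[beta] = {poly int},
   beta = 'X.  Variables x_1..x_n are 'X_0 .. 'X_(n-1) (0-based).       *)

Definition ZB := {poly int}.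
Definition beta : ZB := 'X.

Section Groth.
Variable n : nat.
Local Notation MP := {mpoly ZB[n]}.

(* the variable with 0-based nat index i (0 if out of range, never used) *)
Definition xv (i : nat) : MP :=
  match @insub nat (fun k => (k < n)%N) 'I_n i with
  | Some a => 'X_a | None => 0 end.

Definition sw (i : nat) (f : MP) : MP :=
  match @insub nat (fun k => (k < n)%N) 'I_n i,
        @insub nat (fun k => (k < n)%N) 'I_n i.+1 with
  | Some a, Some b => msym (tperm a b) f
  | _, _ => f end.

(* divided difference: the (unique, since ZB is a domain) g with
   (x_i - x_{i+1}) g = f - s_i f *)
Definition ddiff (i : nat) (f : MP) : MP :=
  epsilon (inhabits 0) (fun g : MP => (xv i - xv i.+1) * g = f - sw i f).

Definition Gtop : MP := \prod_(i < n) 'X_i ^+ (n.-1 - i).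

Definition w0 : seq nat := rev (iota 1 n).

Definition first_ascent (w : seq nat) : nat :=
  find (fun i => (nth 0 w i < nth 0 w i.+1)%N) (iota 0 n.-1).

Definition swap_at (w : seq nat) (i : nat) : seq nat :=
  [seq nth 0 w (if j == i then i.+1 else if j == i.+1 then i else j)
  | j <- iota 0 (size w)].

Fixpoint groth_fuel (fuel : nat) (w : seq nat) : MP :=
  if w == w0 then Gtop else
  match fuel with
  | 0 => 0
  | f.+1 =>
    let i := first_ascent w in
    ddiff i ((1 + beta%:MP * xv i.+1) * groth_fuel f (swap_at w i))
  end.

Definition groth (w : seq nat) : MP := groth_fuel (n * n) w.

End Groth.

Definition Upsilon (w : seq nat) : ZB :=
  (groth (size w) w).@[fun _ => 1].

Definition cpoly (w : seq nat) : ZB :=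
  \sum_(t : (size w).-tuple bool)
     (-1) ^+ (size w - size (mask t w)) * Upsilon (std (mask t w)).

(* Marked reduced pipe dreams.  Tiles use 1-based coordinates (i,k),
   row i from the top, column k from the left, staircase i + k <= m + 1.
   A (marked) pipe dream of size m is a pair (C, M) of sets of cells of
   'I_m * 'I_m, the cell (a,b) standing for tile (a+1, b+1):
   C = crossing tiles, M = marked (bumping) tiles.                       *)

Section PipeDreams.
Variable m : nat.
Local Notation cells := {set 'I_m * 'I_m}.

Definition in_stair (i k : nat) : bool := [&& (0 < i)%N, (0 < k)%N & (i + k <= m.+1)%N].

Definition tile_in (S : cells) (i k : nat) : bool :=
  [&& (0 < i)%N, (0 < k)%N &
      [exists p in S, ((p.1 : nat) == i.-1) && ((p.2 : nat) == k.-1)]].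

(* Tracing a pipe: state (i, k, from_top).  At a crossing a pipe goes
   straight (top->bottom, right->left); at a bumping tile top->left and
   right->bottom.  Leaving column 1 to the left ends the trace.  The
   result is the list of visited (row, column, entered-from-top). *)
Fixpoint trace (c : nat -> nat -> bool) (fuel i k : nat) (top : bool)
  : seq (nat * nat * bool) :=
  match fuel with
  | 0 => [::]
  | f.+1 =>
    if k == 0%N then [::] else
    (i, k, top) :: (if c i k == top then trace c f i.+1 k true
                    else trace c f i k.-1 false)
  end.

Definition pipe (C : cells) (j : nat) : seq (nat * nat * bool) :=
  trace (tile_in C) (2 * m + 2) 1 j true.

Definition traverses (C : cells) (j i k : nat) : bool :=
  has (fun s => (s.1.1 == i) && (s.1.2 == k)) (pipe C j).

Definition exit_row (C : cells) (j : nat) : nat :=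
  (last (0, 0, true) (pipe C j)).1.1.

Definition pipes := iota 1 m.
Definition rows := iota 1 m.
Definition cols := iota 1 m.

Definition cross_at (C : cells) (j j' i k : nat) : bool :=
  [&& tile_in C i k, traverses C j i k & traverses C j' i k].

Definition num_crossings (C : cells) (j j' : nat) : nat :=
  \sum_(i <- rows) \sum_(k <- cols) cross_at C j j' i k.

Definition reduced_for (sigma : seq nat) (C : cells) : bool :=
  [&& [forall p in C, (p.1.+1 + p.2.+1 <= m)%N]
      (* crossings inside the staircase; antidiagonal tiles are bumping *),
      all (fun j => all (fun j' => (j != j') ==> (num_crossings C j j' <= 1)%N)
             pipes) pipes
      (* two pipes cross at most once *) &
      all (fun i => exit_row C (nth 0 sigma i.-1) == i) rows
      (* the pipe exiting row i is sigma(i) *)].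

Definition markable (C : cells) (i k : nat) : bool :=
  [&& in_stair i k, ~~ tile_in C i k &
      has (fun j => has (fun j' =>
        [&& j != j', traverses C j i k, traverses C j' i k &
            has (fun i' => has (fun k' => (i' < i)%N && cross_at C j j' i' k')
                   cols) rows]) pipes) pipes].

Definition MRPD (sigma : seq nat) (C M : cells) : bool :=
  [&& reduced_for sigma C,
      [forall p in M, p \notin C] &
      [forall p in M, markable C p.1.+1 p.2.+1]].

Definition unmarked_bump (C M : cells) (i k : nat) : bool :=
  [&& in_stair i k, ~~ tile_in C i k & ~~ tile_in M i k].

Definition removable (C M : cells) (j : nat) : bool :=
  [&&
      has (fun r => all (fun i =>
             ((i <= r)%N ==> tile_in C i j && traverses C j i j) &&
             ((r < i)%N ==> unmarked_bump C M i j))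
           (iota 1 (m.+1 - j))) (iota 0 m.+1),
      all (fun i => all (fun k =>
             (tile_in C i k && traverses C j i k && (1 < i)%N) ==>
             ~~ unmarked_bump C M i.-1 k) cols) rows &
      all (fun i => all (fun k =>
             (tile_in M i k && ~~ tile_in C i k) ==> ~~ traverses C j i k)
           cols) rows].

Definition core (C M : cells) : bool := all (fun j => ~~ removable C M j) pipes.

End PipeDreams.

Definition dpoly (sigma : seq nat) : ZB :=
  \sum_(P : {set 'I_(size sigma) * 'I_(size sigma)} *
            {set 'I_(size sigma) * 'I_(size sigma)}
       | MRPD sigma P.1 P.2 && core P.1 P.2)
     beta ^+ #|P.2|.

(* Main.v *)
Require Import Defs.
From mathcomp Require Import all_boot all_order all_algebra.
From mathcomp Require Import fingroup perm.
From mathcomp Require Import mpoly.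
From mathcomp Require Import ring zify.
From Stdlib Require Import ClassicalEpsilon.

(* Read a column of a staircase of tiles from top to bottom, as a pipe carried downwards that
   meets the pipes coming from the right: a tile is an unmarked bump, or else a crossing or a
   marked bump according to which of the two pipes is larger.  Hence the marked reduced pipe
   dreams for w are the words in the 0-Hecke operators 1 + x_i pi_i (with pi_i^2 = beta pi_i)
   whose product contributes to w.  By the Yang-Baxter relation this product, multiplied by
   1 + x_(i+1) pi_i, is symmetric in x_i and x_(i+1), which is the divided difference recursion
   of the Grothendieck polynomials; so Upsilon_w counts the marked reduced pipe dreams of w.

   Let S be a set of values of w.  The pipes of S are removable iff in each column k not in S
   every tile from which a pipe of S leaves to the left repeats the kind (unmarked bump or not)
   of the tile above it, and each column k in S consists of crossings followed by unmarked
   bumps.  Such repeated tiles can be deleted, and they can be uniquely reinserted from the left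
   unless the carried pipe c is larger than the pipe j in S to be crossed; then k, the last
   output a of a crossing or marked tile, j and c form a 1423 pattern.  So if w avoids 1423,
   the marked reduced pipe dreams of w with all of S removable are counted by Upsilon of w
   with S deleted, and inclusion-exclusion over S leaves the core ones. *)

(** No Hecke algebra is built: an element is represented by its coefficient function on words, and
    right multiplication by [1 + a pi_i] becomes the operator [hop a i] on such functions. The
    symmetry goes by induction on columns. The Yang-Baxter relation needs a factor
    [hop (x i.+1) i.+1] before the tile at position [i], and the column does not contain it; it is
    inserted and compensated by [cohop], its inverse up to a scalar [1 + b * a]. These scalars must
    be cancelled at the end, so the argument lives in a domain. Deleting the pipes of S column by
    column requires avoidance for each word entering a later column, and these words are not
    subwords of w. What survives is the order of every pair j < a with j in S: in a column outside S
    no admissible tile exchanges a pair whose smaller pipe is in S, while a column in S merely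
    inserts its own pipe. This suffices to pull a 1423 pattern of the incoming word back to w. The
    formula for Upsilon is the first identity inverted over subwords, which inherit the
    avoidance. *)

Set Implicit Arguments.
Unset Strict Implicit.
Unset Printing Implicit Defensive.

Import Order.TTheory GRing.Theory Num.Theory.
Local Open Scope ring_scope.

(** * Demazure operators and the pipe dream sum *)

(* [perm_size] yields sizes of sequences over [Equality.sort _], which [lia] does not identify
   with sizes of sequences over [nat]. *)
Lemma perm_sizeN (s t : seq nat) : perm_eq s t -> size s = size t.
Proof. exact: perm_size. Qed.

Lemma perm_head_swap (T : eqType) (y o : T) L : perm_eq [:: y, o & L] [:: o, y & L].
Proof. by apply/permPl; apply: (perm_catCA [:: y] [:: o]). Qed.

Lemma perm_insert2 (T : eqType) (y o : T) L O :
  perm_eq (y :: L) O -> perm_eq [:: y, o & L] (o :: O).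
Proof. by rewrite -(perm_cons o) => /(perm_trans (perm_head_swap y o L)). Qed.

Section Hecke.
Variables (R : comNzRingType) (b : R).
Implicit Types (f g : seq nat -> R) (i p : nat) (a : R) (w Y O P : seq nat).

(** [o] is the pipe leaving to the left, and the argument of [f] lists the carried pipe followed by
    those arriving from the right. The three terms are an unmarked bump, a crossing and, with factor
    [b], a marked bump. Equivalently, a word with a descent receives [a] times the coefficient of
    the swapped word and [a * b] times its own. *)
Definition tile a (o : nat) f Y : R :=
  f (o :: Y) +
  (if Y is y :: L then if (y < o)%N then a * (f (y :: o :: L) + b * f (o :: Y)) else 0
   else 0).

Definition hop a i f w : R := tile a (nth 0%N w i) (fun Y => f (take i w ++ Y)) (drop i.+1 w).

Lemma hopE a i f P o Y : size P = i ->
  hop a i f (P ++ o :: Y) = tile a o (fun Z => f (P ++ Z)) Y.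
Proof.
move=> <-; rewrite /hop nth_cat ltnn subnn /= take_size_cat //.
by rewrite drop_cat ltnNge leqnSn /= subSnn /= drop0.
Qed.

Lemma split_at i w : (i < size w)%N ->
  exists P o Y, [/\ size P = i & w = P ++ o :: Y].
Proof.
move=> lt; exists (take i w), (nth 0%N w i), (drop i.+1 w).
by rewrite size_take lt -drop_nth // cat_take_drop.
Qed.

Lemma eq_hop a i f g w : (i < size w)%N ->
  (forall v, perm_eq v w -> f v = g v) -> hop a i f w = hop a i g w.
Proof.
move=> lt; have [P [o [Y [sP ->]]]] := split_at lt => e.
rewrite !hopE // /tile e //; case: Y e => // y L e; rewrite e //.
by rewrite perm_cat2l perm_head_swap.
Qed.

Lemma hop_at a i f P u v Z : size P = i ->
  hop a i f (P ++ u :: v :: Z) = f (P ++ u :: v :: Z) +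
    (if (v < u)%N then a * (f (P ++ v :: u :: Z) + b * f (P ++ u :: v :: Z)) else 0).
Proof. by move=> sP; rewrite hopE. Qed.

Lemma hop_last a i f P o : size P = i -> hop a i f (P ++ [:: o]) = f (P ++ [:: o]).
Proof. by move=> sP; rewrite hopE // /tile addr0. Qed.

Lemma hop_commute a c i j f w : (i.+1 < j < size w)%N ->
  hop a i (hop c j f) w = hop c j (hop a i f) w.
Proof.
case/andP=> ij jw; have [P [u [Y' [sP Dw]]]] := split_at (ltn_trans (ltn_trans (ltnSn i) ij) jw).
case: Y' Dw => [|v Z] Dw; first by move: jw; rewrite Dw size_cat /= sP; lia.
have: (j - i.+2 < size Z)%N by move: jw; rewrite Dw size_cat /=; lia.
case/split_at=> Q [o [Y [sQ DZ]]]; rewrite {}Dw {}DZ.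
have E s t X : P ++ s :: t :: Q ++ X = (P ++ s :: t :: Q) ++ X by rewrite -catA.
have jE s t : size (P ++ s :: t :: Q) = j by rewrite size_cat /= sP sQ; lia.
case: Y => [|y Y].
  have J h s t : hop c j h (P ++ s :: t :: Q ++ [:: o]) = h (P ++ s :: t :: Q ++ [:: o]).
    by rewrite E hop_last.
  by rewrite J !(hop_at a) // !J.
have J h s t : hop c j h (P ++ s :: t :: Q ++ o :: y :: Y) = 
    h (P ++ s :: t :: Q ++ o :: y :: Y) +
    (if (y < o)%N then c * (h (P ++ s :: t :: Q ++ y :: o :: Y) + b * h (P ++ s :: t :: Q ++ o :: y :: Y)) else 0).
  by rewrite !E hop_at.
by rewrite J !(hop_at a) // !J; case: (v < u)%N => //; case: (y < o)%N => //; ring.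
Qed.

(* Since pi^2 = b pi, (1 + a pi)((1 + b a) - a pi) = 1 + b a. *)
Definition cohop a i f w := (1 + b * a) * f w - (hop a i f w - f w).

Lemma cohopK a i f w : (i < size w)%N -> cohop a i (hop a i f) w = (1 + b * a) * f w.
Proof.
move=> lt; have [P [o [Y [sP ->]]]] := split_at lt; case: Y => [|y Y].
  by rewrite /cohop !hop_last //; ring.
rewrite /cohop !hop_at //; case: ltngtP => // [_|_|->]; ring.
Qed.

Let op1 a (h : nat -> nat -> nat -> R) p q r :=
  h p q r + (if (q < p)%N then a * (h q p r + b * h p q r) else 0).
Let op2 a (h : nat -> nat -> nat -> R) p q r :=
  h p q r + (if (r < q)%N then a * (h p r q + b * h p q r) else 0).
Let coop2 a (h : nat -> nat -> nat -> R) p q r :=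
  (1 + b * a) * h p q r - (op2 a h p q r - h p q r).

Let yang_baxter3 x y h u v z : uniq [:: u; v; z] ->
  (1 + b * x) * op1 y (op2 y (op1 x (coop2 y h))) u v z =
  (1 + b * y) * op1 x (op2 x (op1 y (coop2 x h))) u v z.
Proof.
rewrite /= !inE => /and3P[/norP[uv uz] vz _].
rewrite /op1 /coop2 /op2.
case: (ltngtP u v) uv => //= uv _; case: (ltngtP u z) uz => //= uz _;
 case: (ltngtP v z) vz => //= vz _; try (exfalso; lia); try ring.
Qed.

(** As [cohop] inverts [hop] up to a scalar, this says that the product with factors [y] at [i], [y]
    at [i.+1], [x] at [i] and the inverse of [y] at [i.+1] is symmetric in [x] and [y]. Only three
    distinct adjacent letters are involved, so their six orders are checked. *)
Lemma yang_baxter x y i f w : uniq w -> (i.+2 < size w)%N ->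
  (1 + b * x) * hop y i (hop y i.+1 (hop x i (cohop y i.+1 f))) w =
  (1 + b * y) * hop x i (hop x i.+1 (hop y i (cohop x i.+1 f))) w.
Proof.
move=> Uw lt.
have [P [u [Y' [sP Dw]]]] := split_at (ltn_trans (ltn_trans (ltnSn i) (ltnSn i.+1)) lt).
case: Y' Dw => [|v [|z Z]] Dw; try by move: lt; rewrite Dw size_cat /= sP; lia.
have U3: uniq [:: u; v; z].
  have: uniq (P ++ [:: u; v; z] ++ Z) by rewrite -[_ ++ Z]/[:: u, v, z & Z] -Dw.
  by rewrite !cat_uniq => /and3P[_ _ /and3P[]].
rewrite {}Dw.
have H1 a h p q r : hop a i h (P ++ p :: q :: r :: Z) =
    op1 a (fun p q r => h (P ++ p :: q :: r :: Z)) p q r by rewrite hop_at.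
have H2 a h p q r : hop a i.+1 h (P ++ p :: q :: r :: Z) =
    op2 a (fun p q r => h (P ++ p :: q :: r :: Z)) p q r.
  by rewrite -cat_rcons hop_at ?size_rcons ?sP // -!cats1 -!catA.
pose h p q r := f (P ++ p :: q :: r :: Z).
suff E c d : hop d i (hop d i.+1 (hop c i (cohop d i.+1 f))) (P ++ u :: v :: z :: Z) =
    op1 d (op2 d (op1 c (coop2 d h))) u v z by rewrite !E; exact: yang_baxter3.
by rewrite H1 /op1 !H2 /op2 !H1 /op1 /cohop !H2.
Qed.

Fixpoint colop (x : nat -> R) p m f :=
  if m is m'.+1 then colop x p.+1 m' (hop (x p) p f) else f.

(** The product of [colop], but consuming the output word from the top: [colop] suits commutation
    arguments, [transfer] suits induction on the word. *)
Fixpoint transfer (x : nat -> R) p f O :=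
  if O is o :: O' then transfer x p.+1 (tile (x p) o f) O' else f [::].

Definition on_head (k : nat) f Y := if Y is y :: L then if y == k then f L else 0 else 0.

(* The coefficient of w in the product, over the columns of a staircase with pipes V, of
   the 0-Hecke elements 1 + x_i pi_i: this is the Fomin-Kirillov pipe dream sum for w. *)
Fixpoint pdsum (x : nat -> R) (V w : seq nat) : R :=
  if V is k :: V' then transfer x 0 (on_head k (pdsum x V')) w else (w == [::])%:R.

Lemma eq_colop x p m f g w : (p + m < size w)%N ->
  (forall v, perm_eq v w -> f v = g v) -> colop x p m f w = colop x p m g w.
Proof.
elim: m p f g => [|m IH] p f g lt e /=; first exact: e.
apply: IH => [|v pv]; first by rewrite addSnnS.
apply: eq_hop => [|v' pv']; first by rewrite (perm_sizeN pv); lia.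
by apply: e; apply: perm_trans pv.
Qed.

Lemma colopD x p m1 m2 f : colop x p (m1 + m2) f = colop x (p + m1) m2 (colop x p m1 f).
Proof. by elim: m1 p f => [|m IH] p f /=; rewrite ?addn0 // IH addSnnS. Qed.

Lemma eq_transfer x p f g O : (forall v, perm_eq v O -> f v = g v) ->
  transfer x p f O = transfer x p g O.
Proof.
elim: O p f g => [|o O IH] p f g e /=; first exact: e.
apply: IH => v pv; rewrite /tile e ?perm_cons //; case: v pv => // y L pv.
by rewrite e // perm_insert2.
Qed.

Lemma colop_transfer x f P O p m : size P = p -> size O = m.+1 ->
  colop x p m f (P ++ O) = transfer x p (fun Y => f (P ++ Y)) O.
Proof.
elim: m O P p f => [|m IH] [|o O] P p f //= sP [sO].
  by case: O sO => // _; rewrite /= /tile addr0.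
rewrite -cat_rcons IH ?size_rcons ?sP //; apply: eq_transfer => v _.
by rewrite cat_rcons hopE.
Qed.

Lemma pdsum_cons x k V w : size w = (size V).+1 ->
  pdsum x (k :: V) w = colop x 0 (size V) (on_head k (pdsum x V)) w.
Proof. by move=> sw; rewrite -[w in RHS]cat0s (colop_transfer _ _ (erefl : size [::] = 0%N) sw). Qed.

Lemma hop_colop x a i p m f w : (i.+1 < p)%N -> (p + m < size w)%N ->
  hop a i (colop x p m f) w = colop x p m (hop a i f) w.
Proof.
elim: m p f w => [|m IH] p f w ip lt //=.
rewrite IH ?addSnnS //; last by lia.
apply: eq_colop => [|v pv]; first by rewrite addSnnS.
by rewrite hop_commute // ip (perm_sizeN pv); lia.
Qed.

Lemma colop_hop x a j p m f w : (p + m < j)%N -> (j < size w)%N ->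
  hop a j (colop x p m f) w = colop x p m (hop a j f) w.
Proof.
elim: m p f w => [|m IH] p f w ip lt //=.
rewrite IH ?addSnnS //.
apply: eq_colop => [|v pv]; first by lia.
by rewrite -hop_commute // (perm_sizeN pv); lia.
Qed.

End Hecke.

Section Morphism.
Variables (R R' : comNzRingType) (phi : {rmorphism R -> R'}) (b : R).

Lemma rmorph_tile a o f Y : phi (tile b a o f Y) = tile (phi b) (phi a) o (phi \o f) Y.
Proof.
rewrite /tile rmorphD /=; case: Y => [|y Y]; first by rewrite rmorph0.
by rewrite (fun_if phi) rmorph0 rmorphM rmorphD rmorphM.
Qed.

Lemma rmorph_hop a i f w : phi (hop b a i f w) = hop (phi b) (phi a) i (phi \o f) w.
Proof. exact: rmorph_tile. Qed.

Lemma rmorph_transfer x p f O : phi (transfer b x p f O) = transfer (phi b) (phi \o x) p (phi \o f) O.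
Proof.
elim: O p f => [|o O IH] p f //=; rewrite IH.
by apply: eq_transfer => v _; rewrite /= rmorph_tile.
Qed.

Lemma rmorph_pdsum x V w : phi (pdsum b x V w) = pdsum (phi b) (phi \o x) V w.
Proof.
elim: V w => [|k V IH] w /=; first exact: rmorph_nat.
rewrite rmorph_transfer; apply: eq_transfer => [[|y L]] _ /=; rewrite ?rmorph0 //.
by rewrite (fun_if phi) IH rmorph0.
Qed.

Lemma rmorph_colop x p m f w : (p + m < size w)%N ->
  phi (colop b x p m f w) = colop (phi b) (phi \o x) p m (phi \o f) w.
Proof.
elim: m p f => [|m IH] p f lt //=; rewrite IH ?addSnnS //.
apply: eq_colop => [|v pv]; first by rewrite addSnnS.
by rewrite /= rmorph_hop.
Qed.

End Morphism.

Section Hop.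
Variables (R : comNzRingType) (b : R) (x : nat -> R) (i : nat).
Implicit Types (f g : seq nat -> R) (w v : seq nat).

Lemma eq_colop_var (z : nat -> R) p m f w : (forall j, (p <= j < p + m)%N -> z j = x j) ->
  colop b z p m f w = colop b x p m f w.
Proof.
elim: m p f => [|m IH] p f e //=; rewrite e ?leqnn ?addnS ?ltnS ?leq_addr // IH //.
by move=> j jl; apply: e; lia.
Qed.

(** The bottom tile of each column carries no variable, so the longest column uses only the first
    [(size V).-1] of them. *)
Lemma eq_pdsum_var (z : nat -> R) V w : size w = size V ->
  (forall j, (j.+1 < size V)%N -> z j = x j) -> pdsum b z V w = pdsum b x V w.
Proof.
elim: V w => [|k V IH] w //= sw e.
rewrite -/(pdsum b z (k :: V) w) -/(pdsum b x (k :: V) w) !pdsum_cons //.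
rewrite (eq_colop_var (z := z)); last by move=> j; rewrite add0n => /= jl; apply: e.
apply: eq_colop => [|v pv]; first by rewrite sw.
case: v pv => // y L pv /=; rewrite IH //; last by move=> j jl; apply: e; lia.
by move/perm_sizeN: pv; rewrite sw => -[].
Qed.

(** Position [i.+1] behind the new pipe is position [i] of the word arriving from the right. This
    shift is what lets the induction on columns reach the preceding sum. *)
Lemma hop_on_head a k f w : (i.+1 < size w)%N ->
  hop b a i.+1 (on_head k f) w = on_head k (hop b a i f) w.
Proof.
case: w => // y L /= lt; rewrite /hop /tile /=.
by case: (y == k) => //; case: (drop _ _) => [|u Z]; rewrite ?addr0 // mulr0 addr0 mulr0 if_same add0r.
Qed.

Lemma hop_scale a c j f w : hop b a j (fun v => c * f v) w = c * hop b a j f w.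
Proof.
rewrite /hop /tile; case: (drop _ _) => [|u Z]; first by rewrite !addr0.
by case: (_ < _)%N; ring.
Qed.

Lemma hop_comm a c j f w : (j < size w)%N -> hop b a j (hop b c j f) w = hop b c j (hop b a j f) w.
Proof.
move=> lt; have [P [o [Y [sP ->]]]] := split_at lt; case: Y => [|y Y]; first by rewrite !hop_last.
by rewrite !hop_at //; case: ltngtP => _ //; ring.
Qed.

End Hop.

(** * The divided difference recursion *)

Section Symmetry.
Variables (R : idomainType) (b : R) (x : nat -> R) (i : nat) (s : {rmorphism R -> R}).
Hypotheses (sb : s b = b) (sx : s (x i) = x i.+1) (sy : s (x i.+1) = x i).
Hypothesis sz : forall j, j != i -> j != i.+1 -> s (x j) = x j.
Hypotheses (nzx : 1 + b * x i != 0) (nzy : 1 + b * x i.+1 != 0).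
Implicit Types (f g : seq nat -> R) (w v : seq nat).

Lemma rmorph_hop3 f v : (i.+2 < size v)%N -> (forall u, perm_eq u v -> s (f u) = f u) ->
  s (hop b (x i.+1) i (hop b (x i.+1) i.+1 (hop b (x i) i (cohop b (x i.+1) i.+1 f))) v) =
  hop b (x i) i (hop b (x i) i.+1 (hop b (x i.+1) i (cohop b (x i) i.+1 f))) v.
Proof.
move=> lt sf; rewrite rmorph_hop sb sy; apply: eq_hop => [|u pu]; first by lia.
have su := perm_sizeN pu.
rewrite /= rmorph_hop sb sy; apply: eq_hop => [|t pt]; first by lia.
have st := perm_sizeN pt.
rewrite /= rmorph_hop sb sx; apply: eq_hop => [|q pq]; first by lia.
have sq := perm_sizeN pq; have pv := perm_trans pq (perm_trans pt pu).
rewrite /= /cohop rmorphB rmorphM rmorphB [s (hop _ _ _ _ _)]rmorph_hop rmorphD rmorphM rmorph1 sb sy (sf q pv).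
congr (_ - (_ - _)); apply: eq_hop => [|u' pu']; first by lia.
by apply: sf; apply: perm_trans pv.
Qed.

Lemma hop_pdsum_sym V w : uniq w -> size w = size V -> (i.+1 < size V)%N ->
  s (hop b (x i.+1) i (pdsum b x V) w) = hop b (x i.+1) i (pdsum b x V) w.
Proof.
elim: V w => [|k V IH] w Uw sw //= lt.
set G := on_head k (pdsum b x V).
have fixcol f v : size v = size w -> (forall u, perm_eq u v -> s (f u) = f u) ->
    s (colop b x 0 i f v) = colop b x 0 i f v.
  move=> sv e; rewrite rmorph_colop ?sb; last by rewrite sv sw /=; lia.
  rewrite (@eq_colop_var _ b x (s \o x)) => [|j jl /=]; last by apply: sz; lia.
  by apply: eq_colop; first by rewrite sv sw /=; lia.
have [r Dr]: exists r, size V = (i + r.+1)%N by exists (size V - i).-1; lia.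
have EF a v : perm_eq v w -> hop b a i (pdsum b x (k :: V)) v =
    hop b a i (colop b x i.+1 r (hop b (x i) i (colop b x 0 i G))) v.
  move=> pv; have sv := perm_sizeN pv.
  apply: eq_hop => [|u pu]; first by rewrite sv sw /=; lia.
  by rewrite pdsum_cons ?(perm_sizeN pu) ?sv // Dr colopD.
rewrite -/(pdsum b x (k :: V)) EF //.
(* For [r = 0] the positions [i] and [i.+1] end the word. The factors with [x i] and [x i.+1] then
   both act at [i] and commute, and everything before them uses only variables of index below
   [i]. *)
case: r => [|r] in Dr EF *; rewrite /=.
  rewrite rmorph_hop sb sy [RHS]hop_comm; last by rewrite sw /=; lia.
  apply: eq_hop => [|v pv]; first by rewrite sw /=; lia.
  rewrite /= rmorph_hop sb sx; apply: eq_hop => [|u pu]; first by rewrite (perm_sizeN pv) sw /=; lia.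
  have su : size u = size w by rewrite (perm_sizeN pu) (perm_sizeN pv).
  apply: fixcol => // t pt; have := perm_sizeN pt; rewrite su sw /G.
  case: t pt => [|y L] pt //= [sL]; rewrite (fun_if s) rmorph0 rmorph_pdsum sb.
  by rewrite (@eq_pdsum_var _ b x) // => j jl; apply: sz; lia.
have lti : (i.+2 + r < size w)%N by rewrite sw /=; lia.
rewrite hop_colop //.
rewrite rmorph_colop // sb (@eq_colop_var _ b x); last by move=> j jl; apply: sz; lia.
apply: eq_colop => // v pv /=; have sv := perm_sizeN pv.
have Uv : uniq v by rewrite (perm_uniq pv).
(* The inserted factor: it moves through the top [i] tiles and, by [hop_on_head], meets the sum over
   the remaining columns exactly as in the induction hypothesis. *)
pose H := hop b (x i.+1) i.+1 (colop b x 0 i G).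
have sH u : perm_eq u v -> s (H u) = H u.
  move=> pu; have su : size u = size w by rewrite (perm_sizeN pu).
  rewrite /H colop_hop //; last by rewrite su; lia.
  apply: fixcol => // t pt; have st: size t = size w by rewrite (perm_sizeN pt).
  rewrite hop_on_head; last by rewrite st; lia.
  case: t pt st => [|y L] pt; rewrite sw //= => -[sL].
  rewrite (fun_if s) rmorph0 IH //; last by lia.
  by move: Uv; rewrite -(perm_uniq pu) -(perm_uniq pt) => /andP[].
set K := hop b _ i _ v.
pose T c d := hop b d i (hop b d i.+1 (hop b c i (cohop b d i.+1 H))) v.
(* [cohop] removes the factor inserted in [H] at the price of [1 + b * x i.+1]. The other scalar
   makes both sides of the Yang-Baxter relation comparable after applying [s]. *)
have KE : (1 + b * x i) * ((1 + b * x i.+1) * K) = (1 + b * x i) * T (x i) (x i.+1).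
  congr (_ * _); rewrite /K -hop_scale; apply: eq_hop => [|u pu]; first by lia.
  have su := perm_sizeN pu; rewrite -hop_scale; apply: eq_hop => [|t pt]; first by lia.
  have st := perm_sizeN pt; rewrite -hop_scale; apply: eq_hop => [|q pq]; first by lia.
  by rewrite /H cohopK // (perm_sizeN pq); lia.
have YB : (1 + b * x i) * T (x i) (x i.+1) = (1 + b * x i.+1) * T (x i.+1) (x i).
  by apply: yang_baxter => //; lia.
have sT : s (T (x i) (x i.+1)) = T (x i.+1) (x i).
  by apply: rmorph_hop3 sH; lia.
clearbody K T; apply: (mulfI nzy); apply: (mulfI nzx); rewrite KE YB -sT.
by have := congr1 s KE; rewrite !rmorphM !rmorphD !rmorphM !rmorph1 sb sx sy mulrCA.
Qed.

(** At an ascent [hop] acts trivially, so the sum for [w] is itself invariant under [s]. At the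
    swapped word the invariant is [f + x i.+1 * pdsum b x V w]; comparing it with its image under
    [s] gives the equation. *)
Lemma pdsum_ascent V w P (u v : nat) Y : w = P ++ u :: v :: Y -> size P = i -> uniq w ->
  size w = size V -> (u < v)%N ->
  (x i - x i.+1) * pdsum b x V w =
  let f := (1 + b * x i.+1) * pdsum b x V (P ++ v :: u :: Y) in f - s f.
Proof.
move=> Dw sP Uw sw uv.
have pw : perm_eq (P ++ v :: u :: Y) w.
  by rewrite Dw perm_cat2l perm_head_swap.
have ltV : (i.+1 < size V)%N by rewrite -sw Dw size_cat /= sP; lia.
have := hop_pdsum_sym Uw sw ltV; rewrite Dw !hop_at // ltnNge ltnW //= addr0 -Dw => sw'.
have Uv : uniq (P ++ v :: u :: Y) by rewrite (perm_uniq pw).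
have := hop_pdsum_sym Uv (etrans (perm_sizeN pw) sw) ltV.
rewrite !hop_at // uv -Dw rmorphD !rmorphM !rmorphD !rmorphM rmorph1 sw' sy sb => e.
apply/eqP; rewrite -subr_eq0; apply/eqP; move/eqP: e; rewrite -subr_eq0 => /eqP <-; ring.
Qed.

End Symmetry.

(** * Specialized Grothendieck polynomials *)

Section Head.
Variables (R : comNzRingType) (b : R) (x : nat -> R).

Lemma transfer_scale c p f O :
  transfer b x p (fun Y => c * f Y) O = c * transfer b x p f O.
Proof.
elim: O p f => [|o O IH] p f //=; rewrite -IH; apply: eq_transfer => v _.
rewrite /tile; case: v => [|y L]; first by rewrite !addr0.
by case: ifP => _; ring.
Qed.

(** The pipe [k] enters at the top and is the smallest: until it leaves, each tile must be a
    crossing, of weight [x], and it leaves through an unmarked bump. *)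
Lemma transfer_head k p g O1 O2 : all (fun o => k < o)%N O1 -> all (fun o => k < o)%N O2 ->
  transfer b x p (on_head k g) (O1 ++ k :: O2) =
  (\prod_(q < size O1) x (p + q)) *
  transfer b x (p + size O1).+1 (fun Y => g (O1 ++ Y)) O2.
Proof.
move=> lt1 lt2; elim: O1 p g lt1 => [|o O1 IH] p g /=.
  move=> _; rewrite big_ord0 mul1r addn0; apply: eq_transfer => v pv.
  rewrite /tile /= eqxx; case: v pv => [|y L] pv; first by rewrite addr0.
  by rewrite ltnNge ltnW ?addr0 //; apply: (allP lt2); rewrite -(perm_mem pv) mem_head.
case/andP=> ko lt1; rewrite big_ord_recl addn0 -mulrA -(addSnnS p).
rewrite (eq_bigr (fun q : 'I_(size O1) => x (p.+1 + q)%N)); last first.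
  by move=> q _; rewrite addSnnS.
rewrite -(IH p.+1 (fun Y => g (o :: Y)) lt1) -transfer_scale; apply: eq_transfer => v _.
rewrite /tile /on_head gtn_eqF // add0r; case: v => [|y L]; first by rewrite mulr0.
by case: eqP => [->|]; rewrite ?ko mulr0 ?addr0 ?mulr0 ?if_same.
Qed.

Lemma pdsum_rev m n :
  pdsum b x (iota m n) (rev (iota m n)) = \prod_(i < n) x i ^+ (n.-1 - i).
Proof.
elim: n m => [|n IH] m; first by rewrite big_ord0.
rewrite [iota m _]/= rev_cons /= -cats1 transfer_head //=; last first.
  by apply/allP => j; rewrite mem_rev mem_iota => /andP[].
rewrite cats0 IH size_rev size_iota big_ord_recr /= subnn expr0 mulr1 -big_split /=.
by apply: eq_bigr => -[i /= lt] _; rewrite -exprS; congr (_ ^+ _); lia.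
Qed.

End Head.

(** Each call of the Grothendieck recursion swaps an ascent and lowers this number by one, so it
    bounds the fuel required. *)
Fixpoint noninv (w : seq nat) : nat :=
  if w is u :: w' then count (fun v => u < v)%N w' + noninv w' else 0%N.

Lemma noninv_swap P u v Y : (u < v)%N ->
  noninv (P ++ u :: v :: Y) = (noninv (P ++ v :: u :: Y)).+1.
Proof.
move=> uv; elim: P => [|o P IH] /=; first by rewrite uv ltnNge ltnW //=; lia.
by rewrite IH addnS !count_cat /= [((o < u) + _)%N]addnCA.
Qed.

Lemma noninv_max w : (noninv w <= size w * size w)%N.
Proof.
elim: w => //= u w IH; have := count_size (fun v => u < v)%N w; nia.
Qed.

Lemma first_ascentP (w : seq nat) : is_perm w -> w != w0 (size w) ->
  exists P u v Y, [/\ w = P ++ u :: v :: Y, size P = first_ascent (size w) w & (u < v)%N].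
Proof.
move=> pw nw; rewrite /first_ascent.
pose a i := (nth 0 w i < nth 0 w i.+1)%N; rewrite -/a.
have [hs|hn] := boolP (has a (iota 0 (size w).-1)).
  have := nth_find 0%N hs; have := hs; rewrite has_find size_iota; set i := find _ _ => lt.
  rewrite nth_iota // add0n /a => luv.
  exists (take i w), (nth 0%N w i), (nth 0%N w i.+1), (drop i.+2 w); split => //.
    by rewrite -!drop_nth ?cat_take_drop //; lia.
  by rewrite size_take; case: ltnP => //; lia.
case/eqP: nw; rewrite /w0; apply: (@sorted_eq _ (fun u v => (v <= u)%N)).
- by move=> u v t /= ? ?; lia.
- by move=> u v /= /andP[? ?]; lia.
- apply/(sortedP 0%N) => i lt; rewrite leqNgt; apply/negP => luv.
  by case/hasP: hn; exists i => //; rewrite mem_iota; lia.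
- by rewrite rev_sorted iota_sorted.
- by apply: perm_trans pw _; rewrite perm_sym perm_rev.
Qed.

Lemma swap_atE (P : seq nat) u v Y : swap_at (P ++ u :: v :: Y) (size P) = P ++ v :: u :: Y.
Proof.
apply: (@eq_from_nth _ 0%N) => [|j]; first by rewrite size_map size_iota !size_cat.
rewrite size_map size_iota => lt; rewrite (nth_map 0%N) ?size_iota // nth_iota // add0n.
case: eqP => [->|nj]; first by rewrite !nth_cat ltnn ltnNge leqnSn /= subnn subSnn.
case: eqP => [->|nj']; first by rewrite !nth_cat ltnn ltnNge leqnSn /= subnn subSnn.
rewrite !nth_cat; case: ltnP => // le.
have: (j - size P > 1)%N.
  have {}le : (size P <= j)%N := le; have {}nj : j <> size P := nj; have {}nj' : j <> (size P).+1 := nj'; lia.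
by case: (j - size P)%N => [|[|]].
Qed.

Section Groth.
Variable n : nat.
Local Notation MP := {mpoly ZB[n]}.
Local Notation xv := (@xv n).

Lemma xvE i (lt : (i < n)%N) : xv i = 'X_(Ordinal lt).
Proof.
rewrite /xv; case: insubP => [a _ ea|]; last by rewrite lt.
by congr 'X_ _; apply: val_inj.
Qed.

Lemma xv_out i : (n <= i)%N -> xv i = 0.
Proof. by move=> le; rewrite /xv insubF // ltnNge le. Qed.

Lemma meval1_xv i : (i < n)%N -> (xv i).@[fun _ => 1] = 1.
Proof. by move=> lt; rewrite (xvE lt) mevalXU. Qed.

Lemma Dbeta_neq0 i : 1 + beta%:MP * xv i != 0 :> MP.
Proof.
apply/eqP => /(congr1 (meval (fun _ => 0))) /eqP.
rewrite rmorphD rmorph1 rmorphM /= [X in _ * X](_ : _ = 0) ?mulr0 ?addr0 ?rmorph0 ?oner_eq0 //.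
case: (ltnP i n) => [lt|le]; first by rewrite (xvE lt) mevalXU.
by rewrite xv_out // rmorph0.
Qed.

Lemma xvB_neq0 i : (i.+1 < n)%N -> xv i - xv i.+1 != 0.
Proof.
move=> lt; rewrite (xvE lt) (xvE (ltnW lt)).
apply/eqP => /(congr1 (meval (fun j : 'I_n => (j == i :> nat)%:R : ZB))) /eqP.
rewrite rmorphB rmorph0 /= !mevalXU /= eqxx gtn_eqF //= subr0; exact/negP/oner_neq0.
Qed.

Lemma msym_X (s : 'S_n) a : msym s ('X_a : MP) = 'X_(s a).
Proof.
rewrite msymX; congr 'X_[_]; apply/mnmP => j; rewrite mnmE !mnm1E.
by rewrite (can2_eq (permK s) (permKV s)).
Qed.

Lemma msym_C (s : 'S_n) c : msym s (c%:MP : MP) = c%:MP.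
Proof. by rewrite -[c%:MP]mulr1 mul_mpolyC msymZ msym1. Qed.

Lemma groth_fuelE f w : is_perm w -> size w = n -> (noninv w <= f)%N ->
  groth_fuel n f w = pdsum (beta%:MP : MP) xv (iota 1 n) w.
Proof.
elim: f w => [|f IH] w pw sw le /=.
  case: eqP => [->|/eqP nw].
    by rewrite /w0 pdsum_rev /Gtop; apply: eq_bigr => -[i lt] _; rewrite (xvE lt).
  rewrite -sw in nw; have [P [u [v [Y [Dw _ uv]]]]] := first_ascentP pw nw.
  by move: le; rewrite Dw noninv_swap.
case: eqP => [->|/eqP nw].
  by rewrite /w0 pdsum_rev /Gtop; apply: eq_bigr => -[i lt] _; rewrite (xvE lt).
rewrite -sw in nw; have [P [u [v [Y [Dw sP uv]]]]] := first_ascentP pw nw.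
rewrite sw in sP nw; rewrite -sP {1}Dw swap_atE; set i := size P.
have lti : (i.+1 < n)%N by rewrite -sw Dw size_cat /=; lia.
have pw' : perm_eq (P ++ v :: u :: Y) w.
  by rewrite Dw perm_cat2l perm_head_swap.
have sw' : size (P ++ v :: u :: Y) = n by rewrite (perm_sizeN pw').
rewrite IH //; last 2 first.
- by rewrite /is_perm (perm_trans pw') // sw' -sw.
- by move: le; rewrite Dw noninv_swap.
set F := _ * _; pose s := msym (tperm (Ordinal (ltnW lti)) (Ordinal lti)) : {rmorphism MP -> MP}.
have Es h : Defs.sw i h = s h :> MP.
  rewrite /Defs.sw; case: insubP => [a _ ea|]; last by rewrite ltnW.
  case: insubP => [c _ ec|]; last by rewrite lti.
  have -> : a = Ordinal (ltnW lti) by apply: val_inj.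
  by have -> : c = Ordinal lti by apply: val_inj.
have Ui : uniq w by rewrite (perm_uniq pw) iota_uniq.
have key : (xv i - xv i.+1) * pdsum (beta%:MP : MP) xv (iota 1 n) w = F - s F.
  apply: pdsum_ascent Dw (erefl _) Ui _ uv; last by rewrite size_iota.
  - exact: msym_C.
  - by rewrite (xvE lti) (xvE (ltnW lti)) /s /= msym_X tpermL.
  - by rewrite (xvE lti) (xvE (ltnW lti)) /s /= msym_X tpermR.
  - move=> j /eqP nj /eqP nj'; case: (ltnP j n) => [lt|le']; last by rewrite xv_out ?rmorph0.
    by rewrite (xvE lt) /s /= msym_X tpermD //; apply/eqP => -[] e; [case: nj|case: nj'].
  - exact: Dbeta_neq0.
  - exact: Dbeta_neq0.
(* [epsilon] picks some solution of the defining equation: [key] shows that one exists, and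
   cancelling [xv i - xv i.+1] shows that it is the only one. *)
rewrite /ddiff; set Q := fun g : MP => _.
have: exists g, Q g by exists (pdsum (beta%:MP : MP) xv (iota 1 n) w); rewrite /Q Es.
move/(epsilon_spec (inhabits 0)); rewrite {1}/Q Es -key.
by apply: mulfI; apply: xvB_neq0.
Qed.

End Groth.

Theorem Upsilon_pdsum w : is_perm w ->
  Upsilon w = pdsum beta (fun _ => 1) (iota 1 (size w)) w.
Proof.
move=> pw; rewrite /Upsilon /groth groth_fuelE //; last exact: noninv_max.
rewrite rmorph_pdsum /= mevalC; apply: eq_pdsum_var; rewrite size_iota // => j lt.
by rewrite /= meval1_xv // ltnW.
Qed.

(** * Deleting removable pipes from a column *)

Section SubseqIndex.
Variable T : eqType.
Implicit Types s t : seq T.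

(** Turns pattern containment into inequalities between positions, which can be compared across
    rearranged words. *)
Lemma subseq_index s t : uniq s ->
  subseq t s = all (mem s) t && sorted (fun u v => index u s < index v s)%N t.
Proof.
move=> Us; apply/idP/andP => [st|[]].
  split; first by apply/allP => u /(mem_subseq st).
  have tr : transitive (fun u v => index u s < index v s)%N by move=> ? ? ?; apply: ltn_trans.
  apply: (subseq_sorted tr st); case: s Us {st tr} => // z s Us.
  by apply/(sortedP z) => i lt; rewrite !index_uniq // ltnW.
elim: s t Us => [|z s IH] [|u t] //= /andP[zs Us]; rewrite ?sub0seq //.
case/andP=> us ts.
have tr : transitive (fun u v => index u (z :: s) < index v (z :: s))%N.
  by move=> ? ? ?; apply: ltn_trans.
case: (eqVneq u z) => [->|uz] st.
  have zt : z \notin t.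
    by apply/negP => zt; have /allP/(_ _ zt) := order_path_min tr st; rewrite /= eqxx ltn0.
  apply: IH => //.
    apply/allP => v vt; have := allP ts v vt; rewrite /= inE => /predU1P[vz|//].
    by move: zt; rewrite -vz vt.
  have {st} := path_sorted st.
  apply: (@sub_in_sorted _ (mem t)) => [v v' vt v't|]; last exact/allP.
  have [zv zv'] : z != v /\ z != v'.
    by split; apply/eqP => e; move: zt; rewrite e ?vt ?v't.
  by rewrite (negPf zv) (negPf zv') ltnS.
have nz v : v \in u :: t -> z != v.
  rewrite inE => /predU1P[->|vt]; first by rewrite eq_sym.
  by apply/eqP => e; have /allP/(_ _ vt) := order_path_min tr st; rewrite /= -e eqxx ltn0.
apply: (IH (u :: t)) => //.
  apply/allP => v vt; have := allP (_ : all (mem (z :: s)) (u :: t)) v vt.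
  by rewrite /= us ts inE eq_sym (negPf (nz v vt)) /= => /(_ isT).
have {st} : sorted (fun u v => (if z == u then 0 else (index u s).+1) <
                                (if z == v then 0 else (index v s).+1))%N (u :: t) := st.
apply: (@sub_in_sorted _ (mem (u :: t))) => [v v' vt v't|]; last exact/allP.
by rewrite (negPf (nz v vt)) (negPf (nz v' v't)) ltnS.
Qed.

End SubseqIndex.

Section Core.
Variables (R : comNzRingType) (b : R) (S : pred nat).
Implicit Types (f g : seq nat -> R) (O Y L w : seq nat).

(* One column, as [transfer] at x = 1, but summing only over the letters for which no pipe of
   [S] obstructs its own removal; [prev] tells that the tile above is an unmarked bump.  A pipe
   of [S] leaving a tile to the left forces that tile to repeat the kind of the tile above. *)
Fixpoint strans (prev : bool) f O : R :=
  if O is o :: O' then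
    if S o then
      if prev then strans true (fun Y => f (o :: Y)) O'
      else strans false
        (fun Y => if Y is y :: L then if (y < o)%N then f (y :: o :: L) else 0 else 0) O'
    else
      strans true (fun Y => f (o :: Y)) O' +
      strans false (fun Y => if Y is y :: L then
        if (y < o)%N then f (y :: o :: L) + b * f (o :: Y) else 0 else 0) O'
  else if prev then f [::] else 0.

(** A column [k] in [S] consists of crossings followed by unmarked bumps, so it only inserts [k]
    somewhere into the incoming word; hence [rem k w]. *)
Fixpoint ssum (V w : seq nat) : R :=
  if V is k :: V' then
    if S k then if k \in w then ssum V' (rem k w) else 0
    else strans false (on_head k (ssum V')) w
  else (w == [::])%:R.

Lemma eq_strans prev f g O : (forall v, perm_eq v O -> f v = g v) ->
  strans prev f O = strans prev g O.
Proof.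
elim: O prev f g => [|o O IH] prev f g e /=; first by rewrite e.
have e1 v : perm_eq v O -> f (o :: v) = g (o :: v) by move=> pv; apply: e; rewrite perm_cons.
case: (S o).
  by case: prev; apply: IH => // -[|y L] pv //; rewrite (e _ (perm_insert2 _ pv)).
by congr (_ + _); apply: IH => // -[|y L] pv //; rewrite (e _ (perm_insert2 _ pv)) (e1 _ pv).
Qed.

Lemma strans_zero prev O : strans prev (fun _ => 0) O = 0.
Proof.
elim: O prev => [|o O IH] prev /=; first by case: prev.
have z (p : bool) (h : seq nat -> R) : h =1 (fun _ => 0) -> strans p h O = 0.
  by move=> e; rewrite -(IH p); apply: eq_strans => v _; rewrite e.
case: (S o); first by case: prev; rewrite z // => -[|y L] //; rewrite if_same.
by rewrite !z ?addr0 // => -[|y L] //; rewrite mulr0 addr0 if_same.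
Qed.

(** As in [transfer_head], only crossings precede the exit of [k]. They are allowed for pipes of [S]
    in state [false], and the bump through which [k] leaves switches the state to [true]. *)
Lemma strans_head k g O1 O2 : ~~ S k ->
  all (fun o => k < o)%N O1 -> all (fun o => k < o)%N O2 ->
  strans false (on_head k g) (O1 ++ k :: O2) = strans true (fun Y => g (O1 ++ Y)) O2.
Proof.
move=> Sk lt1 lt2; elim: O1 g lt1 => [|o O1 IH] g /=.
  move=> _; rewrite (negPf Sk) [X in _ + X](_ : _ = 0) ?addr0.
    by apply: eq_strans => v _; rewrite eqxx.
  rewrite -[RHS](strans_zero false O2); apply: eq_strans => -[|y L] pv //.
  by rewrite ltnNge ltnW //; apply: (allP lt2); rewrite -(perm_mem pv) mem_head.
case/andP=> ko lt1; rewrite -(IH (fun Y => g (o :: Y)) lt1).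
case: (S o); first by apply: eq_strans => -[|y L] _ //=; case: eqP => [->|]; rewrite ?ko ?if_same.
rewrite [X in X + _](_ : _ = 0) ?add0r.
  apply: eq_strans => -[|y L] _ //=; rewrite (gtn_eqF ko) mulr0 addr0.
  by case: eqP => [->|]; rewrite ?ko ?if_same.
by rewrite -[RHS](strans_zero true (O1 ++ k :: O2)); apply: eq_strans => v _; rewrite /= (gtn_eqF ko).
Qed.

(** What an admissible column preserves between incoming word [Y] and output [O]; it is the
    invariant that transports the avoidance of 1423 to the next column. *)
Definition same_order O Y := forall j a : nat, S j -> (j < a)%N -> j \in O -> a \in O ->
  (index a Y < index j Y)%N = (index a O < index j O)%N.

Lemma same_order_cons o O Y : perm_eq Y O -> same_order O Y -> same_order (o :: O) (o :: Y).
Proof.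
move=> pY sY j a Sj ja; rewrite !inE /= ![_ == o]eq_sym.
case: (eqVneq o j) => [_|oj] jO; first by rewrite !ltn0.
case: (eqVneq o a) => [//|oa] aO.
by rewrite !ltnS; apply: sY.
Qed.

(** Only the pair [y < o] changes its order, and its smaller member is outside [S]. *)
Lemma same_order_swap o O y L : perm_eq (y :: L) O -> (y < o)%N -> ~~ S y ->
  same_order O (y :: L) -> same_order (o :: O) (y :: o :: L).
Proof.
move=> pY yo Sy /(same_order_cons (o := o) pY) sY j a Sj ja jO aO.
rewrite -(sY j a Sj ja jO aO) /=.
have yj : (y == j) = false by apply: contraNF Sy => /eqP->.
rewrite yj; case: (eqVneq y a) => [ya|_]; case: (eqVneq o j) => [oj|_]; case: (eqVneq o a) => [oa|_] //; lia.
Qed.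

Definition no_312 O := forall a j c : nat, subseq [:: a; j; c] O -> S j -> ~ (j < c < a)%N.
Definition no_12_below a O := forall j c : nat, subseq [:: j; c] O -> S j -> ~ (j < c < a)%N.

Lemma no_312_cons o O : no_312 (o :: O) -> no_312 O /\ no_12_below o O.
Proof.
move=> n3; split=> [a j c st|j c st]; first by apply: n3; apply: subseq_trans st (subseq_cons _ _).
by apply: n3; rewrite /= eqxx.
Qed.

Local Notation T g O := (transfer b (fun _ => 1) 0 g O).
Local Notation del := (filter (fun u => ~~ S u)).

Lemma transfer1 p g O : transfer b (fun _ => 1) p g O = T g O.
Proof. by elim: O p g => [|o O IH] p g //=; rewrite IH [in RHS]IH. Qed.

Lemma transferD f g O : T (fun Y => f Y + g Y) O = T f O + T g O.
Proof.
elim: O f g => [|q O IH] f g //=.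
rewrite !(transfer1 1) -IH; apply: eq_transfer => v _; rewrite /tile.
by case: v => [|y L]; [ring|case: ifP => _; ring].
Qed.

Lemma transfer_split g o O : transfer b (fun _ => 1) 1 (tile b 1 o g) O = T (fun Y => g (o :: Y)) O +
  T (fun Y => if Y is y :: L then
        if (y < o)%N then g (y :: o :: L) + b * g (o :: Y) else 0 else 0) O.
Proof.
rewrite transfer1 -transferD; apply: eq_transfer => v _.
by rewrite /tile; case: v => // y L; rewrite mul1r.
Qed.

(* In state [false], [a] is the output of the last crossing or marked tile, so that the
   carried pipe is smaller than [a]; [no_12_below] then keeps it below every pipe of S. *)
Lemma strans_transfer O : uniq O -> no_312 O ->
  (forall f g, (forall Y, perm_eq Y O -> same_order O Y -> f Y = g (del Y)) ->
     strans true f O = T g (del O)) /\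
  (forall a f g, g [::] = 0 -> (forall y L, (a <= y)%N -> g (y :: L) = 0) ->
     no_12_below a O ->
     (forall y L, perm_eq (y :: L) O -> same_order O (y :: L) -> ~~ S y ->
        f (y :: L) = g (y :: del L)) ->
     strans false f O = T g (del O)).
Proof.
elim: O => [|o O IH] /=; first by split=> [f g e|a f g g0 *]; [apply: (e [::])|rewrite g0].
case/andP=> oO UO n3; have [n3O n2o] := no_312_cons n3; have [IHt IHf] := IH UO n3O.
have sw y L : perm_eq (y :: L) O -> (y < o)%N -> ~~ S y -> same_order O (y :: L) ->
    perm_eq (y :: o :: L) (o :: O) /\ same_order (o :: O) (y :: o :: L).
  by move=> pY yo Sy sY; split; [exact: perm_insert2|exact: same_order_swap].
split=> [f g e|a f g g0 ga n2 e].
  have e1 Y : perm_eq Y O -> same_order O Y -> f (o :: Y) = g (del (o :: Y)).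
    by move=> pY sY; apply: e; [rewrite perm_cons|apply: same_order_cons].
  case So: (S o) => /=. by apply: IHt => Y pY sY; rewrite e1 //= So.
  rewrite transfer_split; congr (_ + _).
    by apply: IHt => Y pY sY; rewrite e1 //= So.
  apply: (IHf o) => // [y L|y L pY sY Sy]; first by rewrite ltnNge => ->.
  case: ifP => // yo; have [pY' sY'] := sw _ _ pY yo Sy sY.
  by rewrite e // e1 //= So Sy.
case So: (S o) => /=.
  apply: (IHf a) => // [j c st|y L pY sY Sy].
    by apply: n2; apply: subseq_trans st (subseq_cons _ _).
  have yO : y \in O by rewrite -(perm_mem pY) mem_head.
  (* The pipe [o] of [S] has to be crossed, which requires [y < o], whereas after deleting [o]
     nothing is required. If [o < y], then [y < a] would contradict [no_12_below], and for [a <= y]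
     the function [g] vanishes. *)
  case: ltnP => yo; first by have [pY' sY'] := sw _ _ pY yo Sy sY; rewrite e //= So.
  rewrite ga // leqNgt; apply/negP => ya; apply: (n2 o y) => //.
    by rewrite /= eqxx sub1seq.
  by rewrite ya ltn_neqAle yo !andbT; apply: contraNneq oO => ->.
have e1 Y : perm_eq Y O -> same_order O Y -> f (o :: Y) = g (o :: del Y).
  by move=> pY sY; apply: e; rewrite ?perm_cons ?So //; apply: same_order_cons.
rewrite transfer_split; congr (_ + _); first by apply: IHt.
apply: (IHf o) => // [y L|y L pY sY Sy]; first by rewrite ltnNge => ->.
case: ifP => // yo; have [pY' sY'] := sw _ _ pY yo Sy sY.
by rewrite e // e1 //= So Sy.
Qed.

Definition no_1423 w :=
  forall p a j c : nat, subseq [:: p; a; j; c] w -> S j -> ~~ [&& p < j, j < c & c < a]%N.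

(** Given a pattern p a j c in [O1 ++ Y]: if a is in [O1], so is p, and the same letters form a
    pattern in the original word. Otherwise a, j, c all lie in [O2], in the same order by
    [same_order], and [k] takes the place of p. *)
Lemma no_1423_split k O1 O2 Y : uniq (O1 ++ k :: O2) -> all (fun o => k < o)%N O2 ->
  perm_eq Y O2 -> same_order O2 Y -> no_1423 (O1 ++ k :: O2) -> no_1423 (O1 ++ Y).
Proof.
move=> Uw k2 pY sY n4 p a j c; have mY := perm_mem pY.
have UY : uniq (O1 ++ Y).
  move: Uw; rewrite !cat_uniq (perm_uniq pY) /= (eq_has_r mY).
  by case/and3P=> -> /norP[_ ->] /andP[].
rewrite subseq_index //= !mem_cat !index_cat andbT.
case/andP=> /and4P[pO aO jO cO] /and3P[pa aj /andP[jc _]] Sj.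
apply/negP => /and3P[pj ltjc ca].
have sjc : j \in O2 -> c \in O2 -> (index j Y < index c Y)%N -> (index j O2 < index c O2)%N.
  move=> j2 c2 ltY; have := sY j c Sj ltjc j2 c2; rewrite ltnNge [in X in X = _]ltnW //= => /esym/negbT.
  rewrite -leqNgt leq_eqVlt => /orP[/eqP e|//].
  by move: ltjc; rewrite -(nth_index 0%N j2) -(nth_index 0%N c2) e ltnn.
have notO1 (u : nat) : u \in O2 -> (u \in O1) = false /\ (k == u) = false.
  move=> u2; move: Uw; rewrite cat_uniq /= => /and3P[_ /norP[_ /hasPn h] /andP[k2' _]].
  by split; [apply/negbTE/h|apply: contraNF k2' => /eqP->].
have lt1 (u : nat) : u \in O1 -> (index u O1 < size O1)%N by rewrite index_mem.
have noL u x : u \in O1 -> (size O1 + x < index u O1)%N = false.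
  by move=> u1; rewrite ltnNge (leq_trans (ltnW (lt1 u u1)) (leq_addr _ _)).
have isL u x : u \in O1 -> (index u O1 < size O1 + x)%N.
  by move=> u1; apply: leq_trans (lt1 u u1) (leq_addr _ _).
have kj : j \in O2 -> (k < j)%N by move/(allP k2).
case a1: (a \in O1) in aO aj pa; last first.
  have j1 : (j \in O1) = false.
    by apply/negbTE/negP => h; move: aj; rewrite h noL.
  have c1 : (c \in O1) = false.
    by apply/negbTE/negP => h; move: jc; rewrite j1 h noL.
  move: jO cO aO aj jc; rewrite j1 c1 /= !mY !ltn_add2l => j2 c2 a2 aj jc.
  have := n4 k a j c; rewrite subseq_index // => n4'.
  suff /n4'/(_ Sj) : all (mem (O1 ++ k :: O2)) [:: k; a; j; c] &&
     sorted (fun u v => index u (O1 ++ k :: O2) < index v (O1 ++ k :: O2))%N [:: k; a; j; c].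
    by rewrite kj // ltjc ca.
  rewrite /= !mem_cat !inE j2 c2 a2 eqxx !orbT /= !index_cat a1 j1 c1 /= eqxx.
  have -> : k \in O1 = false.
    by apply/negbTE; move: Uw; rewrite cat_uniq /= => /and3P[_ /norP[]].
  rewrite (notO1 a a2).2 (notO1 j j2).2 (notO1 c c2).2 !ltn_add2l !ltnS /= (sjc j2 c2 jc) -(sY j a) //.
    by rewrite aj.
  exact: ltn_trans ltjc ca.
have p1 : p \in O1 by apply: contraTT pa => /negPf->; rewrite noL.
have := n4 p a j c; rewrite subseq_index // => n4'.
suff /n4'/(_ Sj) : all (mem (O1 ++ k :: O2)) [:: p; a; j; c] &&
     sorted (fun u v => index u (O1 ++ k :: O2) < index v (O1 ++ k :: O2))%N [:: p; a; j; c].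
  by rewrite pj ltjc ca.
move: pa jO cO aj jc; rewrite !mY /= !mem_cat !inE !index_cat p1 a1 /= => -> jO cO aj jc.
case j1: (j \in O1) in jO aj jc *; case c1: (c \in O1) in cO jc *; rewrite /= in jO cO *.
- by rewrite aj jc.
- by rewrite aj cO (notO1 c cO).2 orbT /= isL.
- by rewrite noL in jc.
- rewrite jO cO !orbT /= (notO1 c cO).2 (notO1 j jO).2 /=.
  rewrite !ltn_add2l in jc *; by rewrite ltnS (sjc jO cO jc) andbT isL.
Qed.

Theorem ssum_pdsum V w : sorted ltn V -> perm_eq w V -> no_1423 w ->
  ssum V w = pdsum b (fun _ => 1) (del V) (del w).
Proof.
elim: V w => [|k V IH] w /= sV pw n4; first by have /eqP := perm_sizeN pw; rewrite size_eq0 => /eqP->.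
have kw : k \in w by rewrite (perm_mem pw) mem_head.
have Uw : uniq w by rewrite (perm_uniq pw) (sorted_uniq ltn_trans ltnn).
have lt : {in w, forall u, u != k -> (k < u)%N}.
  move=> u; rewrite (perm_mem pw) inE => /predU1P[->|uV]; rewrite ?eqxx // => _.
  exact: (allP (order_path_min ltn_trans sV)).
have pr : perm_eq (rem k w) V.
  by rewrite -(perm_cons k) (perm_trans _ pw) // perm_sym perm_to_rem.
case Sk: (S k) => /=.
  rewrite kw IH ?(path_sorted sV) //; last first.
    by move=> p a j c st; apply: n4; apply: subseq_trans st (rem_subseq _ _).
  congr pdsum; rewrite rem_filter // -filter_predI; apply: eq_filter => u /=.
  by case: eqP => [->|]; rewrite ?Sk ?andbT.
have [O1 [O2 Dw]] : exists O1 O2, w = O1 ++ k :: O2 by case/splitPr: kw => O1 O2; exists O1, O2.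
move: Uw; rewrite {1}Dw cat_uniq /= => /and3P[U1 /norP[k1 n12] /andP[kn2 U2]].
have lt1 : all (fun o => k < o)%N O1.
  by apply/allP => u u1; apply: lt; [rewrite Dw mem_cat u1|apply: contraNneq k1 => <-].
have lt2 : all (fun o => k < o)%N O2.
  by apply/allP => u u2; apply: lt; [rewrite Dw mem_cat inE u2 !orbT|apply: contraNneq kn2 => <-].
have pr2 : perm_eq (O1 ++ O2) V.
  apply: perm_trans pr; rewrite perm_sym -(perm_cons k) -(permPl (perm_to_rem kw)) Dw.
  by apply/permPl; apply: (perm_catCA O1 [:: k]).
rewrite Dw strans_head ?Sk // filter_cat /= Sk /=.
rewrite (transfer_head _ _ _ _) ?all_filter; last 2 first.
- by apply/allP => u u1 /=; rewrite (allP lt1) ?implybT.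
- by apply/allP => u u2 /=; rewrite (allP lt2) ?implybT.
rewrite big1 // mul1r transfer1.
apply: (strans_transfer U2 _).1 => [a j c st Sj jca|Y pY sY].
  (* Every letter after [k] exceeds it, so a 312 pattern there extends by [k] to a 1423 pattern. *)
  have := n4 k a j c; rewrite Dw => /(_ _ Sj)/negP[].
    by apply: (subseq_trans _ (suffix_subseq _ _)); rewrite /= eqxx.
  rewrite jca andbT; apply: (allP lt2); apply: (mem_subseq st); by rewrite !inE eqxx orbT.
rewrite -filter_cat; apply: IH; first exact: path_sorted sV.
  by apply: perm_trans pr2; rewrite perm_cat2l.
move: n4; rewrite Dw; apply: no_1423_split => //.
by rewrite -Dw (perm_uniq pw) (sorted_uniq ltn_trans ltnn).
Qed.

End Core.

(** * Words of tiles *)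

(* Kinds of tiles: [None] for an unmarked bump, [Some false] for a crossing and [Some true]
   for a marked bump.  Column [k] of a pipe dream is the word of its tiles from top to bottom,
   without the last one, which is always an unmarked bump. *)
Local Notation letter := (option bool).
Local Notation U := (@None bool).
Local Notation X := (Some false).
Local Notation M := (Some true).

Fixpoint words n : seq (seq letter) :=
  if n is n'.+1 then [seq l :: u | l <- [:: U; X; M], u <- words n'] else [:: [::]].

Fixpoint arrays n : seq (seq (seq letter)) :=
  if n is n'.+1 then [seq u :: A | u <- words n', A <- arrays n'] else [:: [::]].

Lemma mem_words n u : (u \in words n) = (size u == n).
Proof.
elim: n u => [|n IH] u; first by rewrite inE size_eq0.
apply/allpairsP/idP => [[[l v] /= [_ vn ->]]|]; first by rewrite /= eqSS -IH.
case: u => // l u; rewrite /= eqSS -IH => un; exists (l, u); split=> //=.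
by case: l => [[]|].
Qed.

Lemma words_uniq n : uniq (words n).
Proof.
elim: n => // n IH; apply: allpairs_uniq => // -[l v] [l' v'] _ _ [-> ->] //.
Qed.

Section Columns.
Implicit Types (u : seq letter) (c p : nat) (L O : seq nat).

(** Pipes leaving a column to the left when [c] enters at the top and [L] from the right. The final
    [[:: c]] is the bottom tile, which [u] omits; [carry] below is the pipe entering tile [p] from
    above. *)
Fixpoint step u c L : seq nat :=
  match u, L with
  | l :: u', y :: L' => if l == X then y :: step u' c L' else c :: step u' y L'
  | _, _ => [:: c]
  end.

Fixpoint carry u c L p : nat :=
  match p, u, L with
  | p'.+1, l :: u', y :: L' => carry u' (if l == X then c else y) L' p'
  | _, _, _ => c
  end.

Fixpoint valid u c L : bool :=
  match u, L with
  | l :: u', y :: L' => [&& (l == X) ==> (c < y)%N, (l == M) ==> (y < c)%N &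
                          valid u' (if l == X then c else y) L']
  | _, _ => true
  end.

Definition marks u := count_mem M u.

Fixpoint xu u : bool :=
  if u is l :: u' then if l == X then xu u' else all (pred1 U) u else true.

Section Removable.
Variable S : pred nat.

(** The constraint that [strans] imposes, read on the tiles. The bottom tile is an unmarked bump, so
    a pipe of [S] may leave there only below another one. *)
Fixpoint okout (prev : bool) u c L : bool :=
  match u, L with
  | l :: u', y :: L' =>
      (S (if l == X then y else c) ==> if prev then l == U else l == X) &&
      okout (l == U) u' (if l == X then c else y) L'
  | _, _ => S c ==> prev
  end.

Variables (R : comNzRingType) (b : R).

Lemma strans_scale prev a f O : strans b S prev (fun Y => a * f Y) O = a * strans b S prev f O.
Proof.
elim: O prev f => [|o O IH] prev f /=; first by case: prev; rewrite ?mulr0.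
have E (p : bool) (g h : seq nat -> R) : (forall Y, g Y = a * h Y) -> strans b S p g O = a * strans b S p h O.
  by move=> e; rewrite -IH; apply: eq_strans => v _.
case: (S o); first by case: prev; apply: E => // -[|y L]; rewrite ?mulr0 //; case: ifP; rewrite ?mulr0.
rewrite mulrDr; congr (_ + _); apply: E => // -[|y L]; rewrite ?mulr0 //.
by case: ifP => _; [ring|rewrite mulr0].
Qed.

Lemma stransD prev f g O :
  strans b S prev (fun Y => f Y + g Y) O = strans b S prev f O + strans b S prev g O.
Proof.
elim: O prev f g => [|o O IH] prev f g /=; first by case: prev; rewrite ?addr0.
have E (p : bool) (h h1 h2 : seq nat -> R) : (forall Y, h Y = h1 Y + h2 Y) ->
    strans b S p h O = strans b S p h1 O + strans b S p h2 O.
  by move=> e; rewrite -IH; apply: eq_strans => v _.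
case: (S o); first by case: prev; apply: E => // -[|y L]; rewrite ?addr0 //; case: ifP; rewrite ?addr0.
rewrite addrACA; congr (_ + _); apply: E => // -[|y L]; rewrite ?addr0 //.
by case: ifP => _; [ring|rewrite addr0].
Qed.

Lemma strans_sum prev (I : Type) (r : seq I) (f : I -> seq nat -> R) O :
  strans b S prev (fun Y => \sum_(i <- r) f i Y) O = \sum_(i <- r) strans b S prev (f i) O.
Proof.
elim: r => [|i r IH].
  by rewrite big_nil -[RHS](strans_zero b S prev O); apply: eq_strans => v _; rewrite big_nil.
by rewrite big_cons -IH -stransD; apply: eq_strans => v _; rewrite big_cons.
Qed.

Lemma big_words n (F : seq letter -> R) : \sum_(u <- words n.+1) F u =
  \sum_(u <- words n) F (U :: u) + \sum_(u <- words n) F (X :: u) + \sum_(u <- words n) F (M :: u).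
Proof. by rewrite /= cats0 !big_cat /= !big_map addrA. Qed.

Lemma strans_delta prev c L O :
  strans b S prev (fun Y => (Y == c :: L)%:R) O =
  \sum_(u <- words (size L))
    (valid u c L && okout prev u c L && (step u c L == O))%:R * b ^+ marks u.
Proof.
have F (P : bool) (a : R) : P = false -> P%:R * a = 0 by move=> ->; rewrite mul0r.
have sum0 n (P : pred (seq letter)) (g : seq letter -> R) : P =1 pred0 -> \sum_(u <- words n) (P u)%:R * g u = 0.
  by move=> P0; rewrite big1 // => u _; rewrite P0 mul0r.
have z (p : bool) (h : seq nat -> R) O' : h =1 (fun _ => 0) -> strans b S p h O' = 0.
  by move=> e; rewrite -(strans_zero b S p O'); apply: eq_strans => v _; rewrite e.
elim: L c prev O => [|y L IH] c prev.
  case=> [|o [|o' O]]; rewrite big_seq1.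
  - by case: prev; rewrite /= ?andbF ?mul0r.
  - rewrite /= mulr1 !eqseq_cons !andbT [c == o]eq_sym addr0.
    case: (eqVneq o c) => [->|_]; last by rewrite andbF; case: (S o); case: prev.
    by rewrite andbT; case: (S c); case: prev.
  - rewrite [c :: _ == _](_ : _ = false) ?andbF ?mul0r; last by rewrite eqseq_cons andbF.
    rewrite -(strans_zero b S prev [:: o, o' & O]); apply: eq_strans => v pv.
    by case: eqP => // e; move: (perm_sizeN pv); rewrite e.
case=> [|o O]; first by rewrite sum0 => [|[|[[]|] u]]; rewrite /= ?andbF //; case: prev.
rewrite big_words; set A := strans b S true (fun Y => (Y == y :: L)%:R) O.
set B := strans b S false (fun Y => (Y == c :: L)%:R) O.
set C := strans b S false (fun Y => (Y == y :: L)%:R) O.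
rewrite [X in _ = X + _ + _](_ : _ = if (o == c) && (S o ==> prev) then A else 0); last first.
  rewrite /A IH; case: ifP => K; [apply: eq_bigr|apply: big1] => u _; rewrite /= eqseq_cons [c == o]eq_sym.
    by case/andP: K => /eqP<- K; rewrite ?eqxx ?add0n; case: (S o) K; case: prev => //= _; rewrite ?eqxx ?add0n.
  apply: F.
  by apply: contraFF K => /andP[/andP[_ /andP[]]]; case: (o =P c) => //= ->; case: (S c); case: prev.
rewrite [X in _ = _ + X + _](_ : _ = if [&& o == y, c < y & S o ==> ~~ prev]%N then B else 0); last first.
  rewrite /B IH; case: ifP => K; [apply: eq_bigr|apply: big1] => u _; rewrite /= eqseq_cons [y == o]eq_sym.
    by case/and3P: K => /eqP<- -> K; rewrite ?eqxx ?add0n; case: (S o) K; case: prev => //= _; rewrite ?eqxx ?add0n.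
  apply: F.
  apply: contraFF K => /andP[/andP[/andP[-> _] /andP[]]].
  by case: (o =P y) => //= ->; case: (S y); case: prev.
rewrite [X in _ = _ + _ + X](_ : _ = if [&& o == c, y < c & ~~ S o]%N then b * C else 0); last first.
  rewrite /C IH; case: ifP => K.
    rewrite big_distrr; apply: eq_bigr => u _; rewrite /= eqseq_cons [c == o]eq_sym /marks /= add1n exprS mulrCA.
    by case/and3P: K => /eqP<- -> K; rewrite ?eqxx ?add0n; case: (S o) K; case: prev => //= _; rewrite ?eqxx ?add0n.
  apply: big1 => u _; rewrite /= eqseq_cons [c == o]eq_sym.
  apply: F.
  apply: contraFF K => /andP[/andP[/andP[-> _] /andP[]]].
  by case: (o =P c) => //= ->; case: (S c); case: prev.
rewrite /=.
have E1 : strans b S true (fun Y => (o :: Y == c :: y :: L)%:R) O = if o == c then A else 0.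
  case: ifP => oc; first by apply: eq_strans => v _; rewrite eqseq_cons oc.
  by apply: z => v; rewrite eqseq_cons oc.
(* A general [d] treats both kinds of output at once: [d = b] for a pipe outside [S], and [d = 0]
   for one in [S], which may not leave through a marked bump. *)
have E2 (d : R) : strans b S false (fun Y => if Y is y0 :: L0 then if (y0 < o)%N then
      (y0 :: o :: L0 == c :: y :: L)%:R + d * (o :: Y == c :: y :: L)%:R else 0 else 0) O =
    (if (o == y) && (c < y)%N then B else 0) + (if (o == c) && (y < c)%N then d * C else 0).
  rewrite /B /C; case: ifP => [/andP[/eqP-> cy]|oy].
    rewrite (gtn_eqF cy) addr0; apply: eq_strans => -[|v K] _; first by [].
    rewrite !eqseq_cons eqxx (gtn_eqF cy) /= mulr0 addr0; case: (eqVneq v c) => [->|_]; last by rewrite if_same.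
    by rewrite cy.
  rewrite add0r; case: ifP => [/andP[/eqP-> yc]|oc].
    rewrite -strans_scale; apply: eq_strans => -[|v K] _; first by rewrite mulr0.
    rewrite !eqseq_cons eqxx (gtn_eqF yc) andbF add0r /=.
    by case: (eqVneq v y) => [->|_]; rewrite ?yc //= mulr0 if_same.
  apply: z => -[|v K] //; case: ifP => // vo; rewrite !eqseq_cons.
  rewrite [X in (nat_of_bool X)%:R + _](_ : _ = false); last first.
    by apply: contraFF oy => /andP[/eqP <- /andP[oy _]]; rewrite oy -(eqP oy).
  rewrite [X in _ * (nat_of_bool X)%:R](_ : _ = false) ?mulr0 ?addr0 //.
  by apply: contraFF oc => /andP[oc /andP[/eqP <- _]]; rewrite oc -(eqP oc).
have E3 : strans b S false (fun Y => if Y is y0 :: L0 then if (y0 < o)%N then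
      (y0 :: o :: L0 == c :: y :: L)%:R else 0 else 0) O = if (o == y) && (c < y)%N then B else 0.
  have := E2 0; rewrite mul0r if_same addr0 => <-.
  by apply: eq_strans => -[|v K] _ //; rewrite mul0r addr0.
rewrite E1 E2 E3; case So: (S o); case: prev => /=; rewrite ?andbT ?andbF ?addr0 ?add0r ?addrA //.
Qed.

End Removable.
End Columns.

Fixpoint res (V : seq nat) (A : seq (seq letter)) : seq nat :=
  match V, A with
  | k :: V', u :: A' => step u k (res V' A')
  | _, _ => [::]
  end.

Fixpoint shaped n (A : seq (seq letter)) : bool :=
  match n, A with
  | n'.+1, u :: A' => (size u == n') && shaped n' A'
  | 0, [::] => true
  | _, _ => false
  end.

Lemma mem_arrays n A : (A \in arrays n) = shaped n A.
Proof.
elim: n A => [|n IH] A; first by case: A.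
apply/allpairsP/idP => [[[u A'] /= [un An ->]]|]; first by rewrite -mem_words un -IH.
by case: A => //= u A /andP[un sA]; exists (u, A); rewrite /= mem_words IH.
Qed.

Lemma arrays_uniq n : uniq (arrays n).
Proof.
elim: n => // n IH; apply: allpairs_uniq => //; first exact: words_uniq.
by case=> l v [l' v'] _ _ [-> ->].
Qed.

Lemma perm_step u c L : size u = size L -> perm_eq (step u c L) (c :: L).
Proof.
elim: u c L => [|l u IH] c [|y L] //= [su].
case: (l == X); last by rewrite perm_cons IH.
by rewrite (perm_trans _ (perm_head_swap y c L)) // perm_cons IH.
Qed.

Lemma perm_res V A : shaped (size V) A -> perm_eq (res V A) V.
Proof.
elim: V A => [|k V IH] [|u A] //= /andP[/eqP su sA].
have pr := IH _ sA; rewrite (perm_trans (perm_step _ _)) ?perm_cons //.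
by rewrite su (perm_sizeN pr).
Qed.

Section SumRemovable.
Variables (S : pred nat) (R : comNzRingType) (b : R).

Fixpoint good (V : seq nat) (A : seq (seq letter)) : bool :=
  match V, A with
  | k :: V', u :: A' =>
      [&& valid u k (res V' A'), (if S k then xu u else okout S false u k (res V' A'))
        & good V' A']
  | _, _ => true
  end.

Definition nmarks (A : seq (seq letter)) := sumn (map marks A).

Let F (P : bool) (a : R) : P = false -> P%:R * a = 0.
Proof. by move=> ->; rewrite mul0r. Qed.

Lemma sum_bumps c L w :
  \sum_(u <- words (size L))
    [&& all (pred1 U) u, valid u c L & step u c L == w]%:R * b ^+ marks u = (w == c :: L)%:R.
Proof.
elim: L c w => [|y L IH] c w; first by rewrite big_seq1 /= mulr1 eq_sym.
rewrite [size _]/= big_words [X in _ + X]big1 ?addr0 => [|u _]; last by apply: F.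
rewrite [X in _ + X]big1 ?addr0 => [|u _]; last by apply: F.
case: w => [|o w]; first by rewrite big1 // => u _; apply: F; rewrite /= !andbF.
rewrite [o :: w == _]eqseq_cons; case: (eqVneq o c) => [->|oc]; last first.
  by rewrite big1 // => u _; apply: F; rewrite /= eqseq_cons [c == o]eq_sym (negPf oc) !andbF.
by rewrite -IH; apply: eq_bigr => u _; rewrite /= eqseq_cons eqxx.
Qed.

(** With r crossings followed by bumps, [c] is inserted after r letters of [L]. All crossings are
    valid because [c] is the smallest, and [w] determines r. *)
Lemma sum_xu c L w : all (fun y => c < y)%N L ->
  \sum_(u <- words (size L)) [&& xu u, valid u c L & step u c L == w]%:R * b ^+ marks u =
  ((c \in w) && (rem c w == L))%:R.
Proof.
elim: L c w => [|y L IH] c w; first move=> _.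
  rewrite big_seq1 /= mulr1 eq_sym; congr (nat_of_bool _)%:R; apply/eqP/andP => [->|[cw /eqP e]].
    by rewrite mem_head /= eqxx.
  have /perm_sizeN := perm_to_rem cw; rewrite e.
  by case: w cw {e} => [|o [|o' w]] //; rewrite inE => /eqP->.
case/andP=> cy lt; rewrite [size _]/= big_words.
rewrite [X in _ + X]big1 ?addr0 => [|u _]; last by apply: F.
rewrite (eq_bigr (fun u => [&& all (pred1 U) (U :: u), valid (U :: u) c (y :: L) &
   step (U :: u) c (y :: L) == w]%:R * b ^+ marks (U :: u))) //.
have -> : \sum_(u <- words (size L)) [&& all (pred1 U) (U :: u), valid (U :: u) c (y :: L) &
   step (U :: u) c (y :: L) == w]%:R * b ^+ marks (U :: u) = (w == c :: y :: L)%:R.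
  rewrite -sum_bumps [size _]/= big_words [X in _ + X]big1 ?addr0 => [|u _]; last by apply: F.
  by rewrite [X in _ + X]big1 ?addr0 // => u _; apply: F.
case: w => [|o w]; first by rewrite add0r big1 // => u _; apply: F; rewrite /= !andbF.
rewrite /= inE [c == o]eq_sym eqseq_cons.
case: (eqVneq o c) => [->|oc] /=.
  rewrite big1 ?addr0 // => u _; apply: F; rewrite /= eqseq_cons gtn_eqF // !andbF //.
rewrite add0r eqseq_cons; case: (eqVneq o y) => [->|oy]; last first.
  rewrite andbF big1 // => u _; apply: F; rewrite /= eqseq_cons [y == o]eq_sym (negPf oy) !andbF //.
by rewrite -IH //; apply: eq_bigr => u _; rewrite /= eqseq_cons eqxx cy.
Qed.

Theorem ssum_arrays V w : sorted ltn V ->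
  ssum b S V w = \sum_(A <- arrays (size V)) (good V A && (res V A == w))%:R * b ^+ nmarks A.
Proof.
elim: V w => [|k V IH] w /= sV; first by rewrite big_seq1 /= mulr1 eq_sym.
have sV' := path_sorted sV.
rewrite big_allpairs_dep /= exchange_big /=.
transitivity (\sum_(A <- arrays (size V)) (good V A)%:R * b ^+ nmarks A *
   (if S k then ((k \in w) && (rem k w == res V A))%:R else
     strans b S false (fun Y => (Y == k :: res V A)%:R) w)).
  case Sk: (S k).
    case: ifP => kw; last by rewrite big1 // => A _; rewrite mulr0.
    by rewrite IH //; apply: eq_bigr => A _; rewrite mulrAC -natrM mulnb eq_sym.
  rewrite (@eq_strans _ _ _ _ _ (fun Y => \sum_(A <- arrays (size V)) (good V A)%:R * b ^+ nmarks A *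
      (Y == k :: res V A)%:R)).
    by rewrite strans_sum; apply: eq_bigr => A _; rewrite strans_scale.
  move=> [|y L] _; first by rewrite big1 // => A _; rewrite mulr0.
  rewrite /=; case: eqP => [->|yk].
    by rewrite IH //; apply: eq_bigr => A _; rewrite eqseq_cons eqxx mulrAC -natrM mulnb [L == _]eq_sym.
  by rewrite big1 // => A _; rewrite eqseq_cons; case: eqP => // _; rewrite mulr0.
rewrite big_seq [RHS]big_seq; apply: eq_bigr => A; rewrite mem_arrays => sA.
have pr := perm_res sA; rewrite -(perm_sizeN pr).
have fin (g : pred (seq letter)) h : \sum_(u <- words (size (res V A))) (g u)%:R * b ^+ marks u = h ->
    (forall u, g u && good V A = good (k :: V) (u :: A) && (res (k :: V) (u :: A) == w)) ->
    (good V A)%:R * b ^+ nmarks A * h =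
    \sum_(u <- words (size (res V A))) (good (k :: V) (u :: A) && (res (k :: V) (u :: A) == w))%:R * b ^+ nmarks (u :: A).
  move=> <- e; rewrite big_distrr; apply: eq_bigr => u _; rewrite -e /nmarks /= exprD.
  by rewrite mulrACA -natrM mulnb andbC; congr (_ * _); rewrite mulrC.
rewrite /= in fin *; case Sk: (S k) in fin *.
  apply: (fin (fun u => [&& xu u, valid u k (res V A) & step u k (res V A) == w])).
    apply: sum_xu; apply/allP => y; rewrite (perm_mem pr) => yV.
    exact: (allP (order_path_min ltn_trans sV)).
  by move=> u; rewrite -!andbA; do !bool_congr.
rewrite strans_delta; apply: fin => [//|u].
by rewrite -!andbA; do !bool_congr.
Qed.

End SumRemovable.

(** * Local form of the removability conditions *)

Section ColumnLabels.
Implicit Types (u : seq letter) (c p : nat) (L s : seq nat).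

Lemma carry0 u c L : carry u c L 0 = c.
Proof. by case: u L => [|l u] [|y L]. Qed.

Lemma carry_S u c L p : size u = size L -> (p < size L)%N ->
  carry u c L p.+1 = if nth U u p == X then carry u c L p else nth 0%N L p.
Proof.
elim: p u c L => [|p IH] [|l u] c [|y L] //= [su].
  by case: u L {su} => [|? ?] [|? ?].
by rewrite ltnS => lt; rewrite -IH.
Qed.

Lemma nth_step u c L p : size u = size L -> (p <= size L)%N ->
  nth 0%N (step u c L) p = if nth U u p == X then nth 0%N L p else carry u c L p.
Proof.
elim: u c L p => [|l u IH] c [|y L] [|p] //= [su].
  by case: (l == X).
by rewrite ltnS => lt; case: (l == X); rewrite /= IH.
Qed.

Lemma xuP u : reflect (exists r, forall p, (p < size u)%N -> nth U u p = if (p < r)%N then X else U)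
  (xu u).
Proof.
elim: u => [|l u IH] /=; first by left; exists 0%N.
case: eqP => [->|lX].
  apply: (iffP IH) => [[r e]|[[|r] e]]; last 2 first.
  - by have := e 0%N isT.
  - by exists r => p lt; apply: (e p.+1).
  by exists r.+1 => -[|p] //= lt; apply: e.
apply: (iffP andP) => [[/eqP -> /all_nthP aU]|[[|r] e]].
- by exists 0%N => -[|p] //= lt; apply/eqP/aU.
- split; first by have := e 0%N isT; rewrite /= => ->.
  by apply/(all_nthP U) => p lt; have := e p.+1 lt; rewrite /= => ->.
- by have := e 0%N isT.
Qed.

Lemma carry_prefix u c L p : (forall q, (q < p)%N -> nth U u q = X) -> carry u c L p = c.
Proof.
elim: p u c L => [|p IH] [|l u] c [|y L] //= e.
by have := e 0%N isT; rewrite /= => ->; apply: IH => q lt; apply: (e q.+1).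
Qed.

(* At tile [p] of a column word, the pipes of [S] obey conditions (ii) and (iii). *)
Definition unobstructed (S : pred nat) u c L p :=
  (nth U u p = X -> (0 < p)%N -> nth U u p.-1 = U -> ~~ S (carry u c L p) /\ ~~ S (nth 0%N L p)) /\
  (nth U u p = M -> ~~ S (carry u c L p) /\ ~~ S (nth 0%N L p)).

Fixpoint unobs (S : pred nat) (prev : bool) u c L : bool :=
  match u, L with
  | l :: u', y :: L' =>
      [&& [|| l == U, (l == X) && ~~ prev | ~~ S c && ~~ S y] &
      unobs S (l == U) u' (if l == X then c else y) L']
  | _, _ => true
  end.

(** [unobs] inspects both pipes at a tile, [okout] only the one leaving to the left. They agree
    because a carried pipe of [S] that goes through a forbidden tile is caught later, at its own
    exit. *)
Lemma unobs_ok S u c L : size u = size L -> ~~ S c -> unobs S false u c L = okout S false u c L.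
Proof.
suff H (prev : bool) : size u = size L -> prev || ~~ S c ->
    unobs S prev u c L = okout S prev u c L.
  by move=> su Sc; rewrite H ?Sc.
(* In state [false] a carried pipe of [S] cannot leave: crossings keep it carried and keep the
   state, and any bump, including the bottom one, violates the constraint. *)
have bad v d K : size v = size K -> S d -> okout S false v d K = false.
  elim: v d K => [|l v IH] d [|y K] //=; first by move=> _ ->.
  by move=> [sv] Sd; case: l => [[]|] /=; rewrite ?Sd //; rewrite (IH d K sv Sd) andbF.
elim: u prev c L => [|l u IH] prev c [|y L] //=; first by move=> _; case: prev => /= [_|/negPf->]; rewrite ?implybT.
case=> su; case: l => [[]|] /=.
- case: prev => [_|/= Sc]; rewrite ?(negPf Sc) /=.
    case Sy: (S y); first by rewrite andbF bad ?andbF.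
    by rewrite andbT IH ?Sy //; case: (S c).
  by case Sy: (S y); [rewrite bad|rewrite IH ?Sy].
- case: prev => [_|/= Sc]; last by rewrite implybT IH.
  case Sc: (S c); first by rewrite bad ?andbF.
  by rewrite IH ?Sc //; case: (S y).
- by move=> pc; rewrite IH // -[LHS]andTb; congr (_ && _); case: (S c) pc => //; case: prev.
Qed.

Lemma unobsP S u c L : size u = size L ->
  reflect (forall p, (p < size L)%N -> unobstructed S u c L p) (unobs S false u c L).
Proof.
move=> su; suff H (prev : bool) : reflect (forall p, (p < size L)%N ->
    (nth U u p = X -> nth prev (prev :: [seq l == U | l <- u]) p -> ~~ S (carry u c L p) /\ ~~ S (nth 0%N L p)) /\
    (nth U u p = M -> ~~ S (carry u c L p) /\ ~~ S (nth 0%N L p))) (unobs S prev u c L).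
  apply: (iffP (H false)) => e [|p] lt; have [eX eM] := e _ lt; split => // eX'.
  - by move=> _ eU; apply: eX => //=; rewrite (nth_map U) ?su 1?ltnW // eU.
  - by rewrite /= (nth_map U) ?su 1?ltnW // => /eqP eU; apply: eX.
elim: u prev c L su => [|l u IH] prev c [|y L] //=; first by left.
case=> su; apply: (iffP andP) => [[h /(IH (l == U) _ _ su) e] [|p] lt|e] /=.
- split=> ee; move: h; rewrite ee /=; last by case/andP.
  by case: prev => //= /andP.
- by have := e p lt; rewrite (set_nth_default (l == U)) //= size_map su ltnW.
split.
  have [eX eM] := e 0%N isT; case: (l) eX eM => [[]|] //= eX eM; first by apply/andP/eM.
  by case: prev {e} eX => // /(_ erefl isT) h; apply/orP; right; apply/andP.
apply/(IH (l == U)) => // p lt; have := e p.+1 lt.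
by rewrite /= (set_nth_default (l == U)) //= size_map su ltnW.
Qed.

Lemma xu_unobs S u c L : xu u -> size u = size L -> unobs S false u c L.
Proof.
move=> /xuP[r e] su; apply/unobsP => // p lt; rewrite -su in lt; split; rewrite (e p lt).
  by case: ltnP => // pr _ p0; rewrite (e p.-1) ?(leq_ltn_trans (leq_pred _)) // (leq_ltn_trans (leq_pred _) pr).
by case: ltnP.
Qed.

End ColumnLabels.

(** * Crossings and inversions *)

Section Crossings.
Implicit Types (u : seq letter) (a d c p : nat) (L s V : seq nat).

(** The second bound makes [a] occur in [s], and then the first makes [d] occur too; for [a < d]
    this is an inversion. *)
Definition inv a d s := (index d s < index a s < size s)%N.

Definition pairX a d c y := ((c == a) && (y == d)) || ((c == d) && (y == a)).

Fixpoint colcross u c L a d : nat :=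
  match u, L with
  | l :: u', y :: L' =>
      ((l == X) && pairX a d c y) + colcross u' (if l == X then c else y) L' a d
  | _, _ => 0
  end.

Fixpoint Xvalid u c L : bool :=
  match u, L with
  | l :: u', y :: L' => ((l == X) ==> (c < y)%N) && Xvalid u' (if l == X then c else y) L'
  | _, _ => true
  end.

Fixpoint tcross V (A : seq (seq letter)) a d : nat :=
  match V, A with
  | k :: V', u :: A' => colcross u k (res V' A') a d + tcross V' A' a d
  | _, _ => 0
  end.

Fixpoint allX V (A : seq (seq letter)) : bool :=
  match V, A with
  | k :: V', u :: A' => Xvalid u k (res V' A') && allX V' A'
  | _, _ => true
  end.

Lemma colcross_notin u c L a d : (a \notin c :: L) || (d \notin c :: L) -> colcross u c L a d = 0%N.
Proof.
elim: u c L => [|l u IH] c [|y L] //= n; rewrite IH; last first.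
  by case/orP: n => n; apply/orP; [left|right]; apply: contra n; rewrite !inE;
     case: (l == X) => /orP[]->; rewrite ?orbT.
rewrite addn0 /pairX; case: (l == X) => //=.
apply/eqP; rewrite eqb0; apply: contraL n => /orP[] /andP[/eqP<- /eqP<-];
by rewrite !inE !eqxx ?orbT.
Qed.

Lemma colcrossE u c L a d : size u = size L ->
  colcross u c L a d = (\sum_(p < size L)
    ((nth U u p == X) && pairX a d (carry u c L p) (nth 0%N L p)))%N.
Proof.
elim: u c L => [|l u IH] c [|y L] //=; first by rewrite big_ord0.
by case=> su; rewrite big_ord_recl IH.
Qed.

Lemma inv_cons a d y s : a != y -> d != y -> inv a d (y :: s) = inv a d s.
Proof. by move=> ay dy; rewrite /inv /= ![y == _]eq_sym (negPf ay) (negPf dy) !ltnS. Qed.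

Lemma inv_head_a a d s : inv a d (a :: s) = false.
Proof. by rewrite /inv /= eqxx ltn0. Qed.

Lemma inv_head_d a d s : a != d -> inv a d (d :: s) = (a \in s).
Proof. by move=> ad; rewrite /inv /= eqxx eq_sym (negPf ad) /= ltnS index_mem. Qed.

Lemma inv_notin_d a d s : d \notin s -> inv a d s = false.
Proof.
move=> ds; have e : index d s = size s by apply/eqP; rewrite eqn_leq index_size leqNgt index_mem.
by rewrite /inv e ltnNge; case: (ltnP (index a s)) => //; rewrite ?andbF // => /ltnW->.
Qed.

Lemma inv_notin_a a d s : a \notin s -> inv a d s = false.
Proof. by rewrite -index_mem => /negPf as_; rewrite /inv as_ andbF. Qed.

Lemma inv_mono a d y s : y \notin s -> inv a d s -> inv a d (y :: s).
Proof.
move=> ys i; case: (eqVneq a y) => [ay|ay]; first by rewrite ay inv_notin_a in i.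
case: (eqVneq d y) => [dy|dy]; first by rewrite dy inv_notin_d in i.
by rewrite inv_cons.
Qed.

(** A valid crossing turns a non-inverted pair into an inverted one and a bump changes no order, so
    crossings account exactly for the new inversions. *)
Lemma colcross_inv u c L a d : size u = size L -> uniq (c :: L) -> (a < d)%N -> Xvalid u c L ->
  (colcross u c L a d + inv a d (c :: L) = inv a d (step u c L))%N.
Proof.
move=> su UL ad; have nad : a != d by rewrite ltn_eqF.
elim: u c L su UL => [|l u IH] c [|y L] //= [su].
rewrite inE negb_or => /andP[/andP[cy cL] /andP[yL UL]].
have memst v : step u v L =i v :: L by apply/perm_mem/perm_step.
case lX: (l == X) => /=; first case/andP.
- move=> ltcy v; have IH' := IH c L su (introT andP (conj cL UL)) v.
  rewrite /pairX; case: (eqVneq a y) => [ay|nay].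
    subst y; have cd : (c == d) = false by rewrite ltn_eqF // (ltn_trans ltcy).
    rewrite inv_head_a (ltn_eqF ltcy) cd /= inv_cons ?inv_head_a; last 2 first.
    - by rewrite gtn_eqF.
    - by rewrite eq_sym cd.
    by rewrite colcross_notin // !inE negb_or (gtn_eqF ltcy) yL.
  case: (eqVneq d y) => [dy|ndy].
    subst y; rewrite inv_head_d // memst inE colcross_notin ?inE ?negb_or ?(gtn_eqF ltcy) ?yL ?orbT //.
    rewrite andbT [c == a]eq_sym andbF orbF addn0.
    case: (eqVneq a c) => [->|ac]; first by rewrite inv_head_a.
    rewrite add0n inv_cons // ?inv_head_d //; by rewrite (gtn_eqF ltcy).
  rewrite !andbF /= add0n [inv a d (y :: step _ _ _)]inv_cons // -IH'.
  congr (_ + nat_of_bool _)%N; case: (eqVneq a c) => [->|ac]; first by rewrite !inv_head_a.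
  case: (eqVneq d c) => [dc|dc]; last by rewrite !inv_cons.
  by rewrite -dc !inv_head_d // inE (negPf nay).
- move=> v; have IH' := IH y L su (introT andP (conj yL UL)) v.
  rewrite add0n; case: (eqVneq a c) => [ac|ac].
    by rewrite ac !inv_head_a colcross_notin // inE negb_or cy cL.
  case: (eqVneq d c) => [dc|dc].
    by subst c; rewrite !inv_head_d // memst colcross_notin // !inE !negb_or cy cL orbT.
  by rewrite (inv_cons (y :: L)) // (inv_cons (step u y L)) // IH'.
Qed.

(** At an invalid crossing the larger pipe comes from above, so the pair is already inverted there
    and counts twice in the bounded sum. *)
Lemma colcross_Xvalid u c L : size u = size L -> uniq (c :: L) ->
  (forall a d, (a < d)%N -> (colcross u c L a d + inv a d (c :: L) <= 1)%N) -> Xvalid u c L.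
Proof.
elim: u c L => [|l u IH] c [|y L] //= [su].
rewrite inE negb_or => /andP[/andP[cy cL] /andP[yL UL]] h.
have hc : (l == X) ==> (c < y)%N.
  apply/implyP => lX; rewrite ltnNge leq_eqVlt eq_sym (negPf cy) /=; apply/negP => yc.
  have := h _ _ yc; rewrite lX /pairX !eqxx orbT inv_head_d ?mem_head //; last by rewrite ltn_eqF.
  by rewrite addnAC.
rewrite hc; apply: IH => // [|a d ad]; first by case: (l == X); rewrite /= ?cL ?yL.
apply: leq_trans (h _ _ ad); rewrite -addnA addnCA leq_add2l; apply: leq_trans (leq_addl _ _).
case: (l == X).
  case i: (inv a d (c :: L)) => //.
  suff -> : inv a d [:: c, y & L] by [].
  move: i; case: (eqVneq a c) => [->|ac]; first by rewrite inv_head_a.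
  case: (eqVneq d c) => [<-|dc]; first by rewrite !inv_head_d ?(ltn_eqF ad) // inE orbC => ->.
  by rewrite (inv_cons L) // (inv_cons (y :: L)) //; apply: inv_mono.
case i: (inv a d (y :: L)) => //.
by rewrite (@inv_mono _ _ c) // inE negb_or cy.
Qed.

Lemma tcross_notin V A a d : shaped (size V) A -> (a \notin V) || (d \notin V) -> tcross V A a d = 0%N.
Proof.
elim: V A => [|k V IH] [|u A] //= /andP[_ sA]; rewrite !inE !negb_or => n.
have mr := perm_mem (perm_res sA).
rewrite IH //; last by case/orP: n => /andP[_ ->]; rewrite ?orbT.
by rewrite colcross_notin // !inE !negb_or !mr.
Qed.

Lemma inv_cons_min k s a d : k \notin s -> (a < d)%N -> all (ltn k) s -> 
  inv a d (k :: s) = inv a d s.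
Proof.
move=> ks ad ltk; case: (eqVneq a k) => [->|ak]; first by rewrite inv_head_a inv_notin_a.
case: (eqVneq d k) => [dk|dk]; last by rewrite inv_cons.
subst d; rewrite inv_head_d // inv_notin_d //; apply/negbTE/negP => /(allP ltk) /= ka; lia.
Qed.

(** Pipes start in increasing order, so a new column contributes no inversion at its top.
    Reducedness thus becomes a local condition: at each crossing the smaller pipe comes from
    above. *)
Lemma tcross_allX V A : sorted ltn V -> shaped (size V) A ->
  (allX V A -> forall a d, (a < d)%N -> tcross V A a d = inv a d (res V A)) /\
  ((forall a d, (a < d)%N -> (tcross V A a d <= 1)%N) -> allX V A).
Proof.
elim: V A => [|k V IH] [|u A] //= sV /andP[/eqP su sA].
have [IH1 IH2] := IH _ (path_sorted sV) sA; have pr := perm_res sA.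
have su' : size u = size (res V A) by rewrite (perm_sizeN pr).
have ltk : all (ltn k) (res V A) by rewrite (perm_all _ pr); apply: order_path_min sV; exact: ltn_trans.
have kr : k \notin res V A by apply/negP => /(allP ltk); rewrite /= ltnn.
have Ur : uniq (k :: res V A).
  by rewrite /= kr (perm_uniq pr) (sorted_uniq ltn_trans ltnn) // (path_sorted sV).
split=> [/andP[v vA] a d ad|h].
  by rewrite IH1 // -(colcross_inv su' Ur ad v) inv_cons_min.
have vA : allX V A by apply: IH2 => a d ad; apply: leq_trans (h _ _ ad); apply: leq_addl.
rewrite vA andbT; apply: colcross_Xvalid => // a d ad.
by have := h _ _ ad; rewrite IH1 // inv_cons_min.
Qed.

Lemma mem_carry u c L p : (size u <= size L)%N -> carry u c L p \in c :: L.
Proof.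
elim: p u c L => [|p IH] [|l u] c [|y L] //=; rewrite ?mem_head // ltnS => su.
by case: (l == X); have := IH u _ L su; [move=> /(_ c)|move=> /(_ y)]; rewrite !inE => /orP[->|->]; rewrite ?orbT.
Qed.

(* Two pipes meeting at tile [p] have crossed before iff the larger one comes from above. *)
Lemma colcross_take u c L p a d : size u = size L -> uniq (c :: L) -> (a < d)%N -> (p < size L)%N ->
  pairX a d (carry u c L p) (nth 0%N L p) ->
  (colcross (take p u) c L a d + inv a d (c :: L) = (carry u c L p == d))%N.
Proof.
move=> su UL ad; have nad : a != d by rewrite ltn_eqF.
elim: p u c L su UL => [|p IH] [|l u] c [|y L] //= [su].
  move=> _ _; rewrite add0n => /orP[] /andP[/eqP-> /eqP->].
    by rewrite inv_head_a (negPf nad).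
  by rewrite inv_head_d // mem_head eqxx.
rewrite inE negb_or => /andP[/andP[cy cL] /andP[yL UL]]; rewrite ltnS => lt.
set e := if _ then c else y => pX.
have [ae de] : a \in e :: L /\ d \in e :: L.
  have := mem_carry e p (eq_leq su); have : nth 0%N L p \in e :: L by rewrite inE mem_nth ?orbT.
  by move: pX => /orP[] /andP[/eqP-> /eqP->].
have Ue : uniq (e :: L) by rewrite /e; case: (l == X); rewrite /= ?cL ?yL.
rewrite -(IH _ _ _ su Ue lt pX) -addnA addnCA; congr (_ + _)%N.
rewrite /e in ae de *; case lX: (l == X) ae de => /=.
  rewrite !inE => ae de.
  have [ay dy] : a != y /\ d != y.
    by split; [move: ae|move: de] => /orP[/eqP->|] //; apply: contraTneq => ->.
  rewrite /pairX ![y == _]eq_sym (negPf ay) (negPf dy) !andbF add0n.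
  case: (eqVneq a c) => [->|ac]; first by rewrite !inv_head_a.
  case: (eqVneq d c) => [<-|dc]; last by rewrite !inv_cons.
  by rewrite !inv_head_d // inE (negPf ay).
move=> ae de; rewrite add0n; have cyL : c \notin y :: L by rewrite inE negb_or cy.
rewrite inv_cons //; first by apply: contraNneq cyL => <-.
by apply: contraNneq cyL => <-.
Qed.

End Crossings.

(** * Tracing pipes *)

Section Trace.
Variable cr : nat -> nat -> bool.
Implicit Types (f i k : nat) (t : bool).

Definition next (s : nat * nat * bool) : nat * nat * bool :=
  let: (i, k, t) := s in if cr i k == t then (i.+1, k, true) else (i, k.-1, false).

(** Each step goes one tile down or left, so tile [(a, d)] is met after [(a - i) + (k - d)] steps;
    the inequality says that fuel remains for one more. *)
Lemma trace_next f i k t a d e : (a, d, e) \in trace cr f i k t -> (next (a, d, e)).1.2 != 0%N ->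
  (a + k + 1 < f + i + d)%N -> next (a, d, e) \in trace cr f i k t.
Proof.
elim: f i k t => [|f IH] i k t //=; case: (eqVneq k 0%N) => [//|k0].
rewrite !inE => /predU1P[[-> -> ->]|h] n0 lt.
  apply/orP; right; case: ifP n0 => c /= n0; (case: f {IH} lt => [|f] lt; first by lia);
    by rewrite /= (negPf n0) mem_head.
by apply/orP; right; case: ifP h => c h; apply: IH => //; lia.
Qed.

Lemma trace_bounds f i k t a d e : (a, d, e) \in trace cr f i k t -> (i <= a)%N /\ (d <= k)%N.
Proof.
elim: f i k t => [|f IH] i k t //=; case: (eqVneq k 0%N) => [//|k0].
rewrite inE => /predU1P[[-> -> _]|]; first by [].
by case: ifP => _ /IH [] *; lia.
Qed.

Lemma trace_mono f i k t a d e a' d' e' : (a, d, e) \in trace cr f i k t ->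
  (a', d', e') \in trace cr f i k t -> (d < d')%N -> (a' <= a)%N.
Proof.
elim: f i k t => [|f IH] i k t //=; case: (eqVneq k 0%N) => [//|k0].
set r := if _ then _ else _; rewrite !inE => h h' lt.
have rb p q x : (p, q, x) \in r -> (i <= p)%N /\ (q <= k)%N.
  by rewrite /r; case: ifP => _ /trace_bounds[] *; lia.
case/predU1P: h => [[ea ed _]|h]; case/predU1P: h' => [[ea' ed' _]|h'].
- by lia.
- by have := rb _ _ _ h'; lia.
- by have := rb _ _ _ h; lia.
by move: h h' lt; rewrite /r; case: ifP => _; apply: IH.
Qed.

Lemma trace_last f i k t a e x : (a, 1%N, e) \in trace cr f i k t -> cr a 1 != e ->
  last x (trace cr f i k t) = (a, 1%N, e).
Proof.
elim: f i k t x => [|f IH] i k t x //=; case: (eqVneq k 0%N) => [//|k0].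
rewrite inE => /predU1P[[-> <- <-]|h] ce /=.
  by rewrite (negPf ce); case: f {IH}.
by case: ifP h => _ h; apply: IH.
Qed.

Variables (m : nat) (V H : nat -> nat -> nat).

Definition label (s : nat * nat * bool) := let: (i, k, t) := s in if t then V i k else H i k.

(** An antidiagonal tile has no neighbour on its right, hence the smaller bound for entries from the
    right. *)
Definition in_range (s : nat * nat * bool) :=
  let: (i, k, t) := s in [&& 0 < i, 0 < k & if t then i + k <= m.+1 else i + k <= m]%N.

Hypothesis cr_range : forall i k, (0 < i)%N -> (0 < k)%N -> cr i k -> (i + k <= m)%N.
Hypothesis V1 : forall k, (0 < k <= m)%N -> V 1 k = k.
Hypothesis VS : forall i k, (0 < i)%N -> (0 < k)%N -> (i + k <= m)%N ->
  V i.+1 k = if cr i k then V i k else H i k.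
Hypothesis HS : forall i k, (0 < i)%N -> (0 < k)%N -> (i + k <= m)%N ->
  H i k = if cr i k.+1 then H i k.+1 else V i k.+1.

Lemma trace_sound f i k t s : in_range (i, k, t) -> s \in trace cr f i k t ->
  in_range s /\ label s = label (i, k, t).
Proof.
elim: f i k t => [|f IH] i k t //= r; case: (eqVneq k 0%N) => [//|k0].
rewrite inE => /predU1P[->|]; first by [].
have [i0 k0' rt] := and3P r.
case: eqP => c h.
  have le : (i + k <= m)%N by case: (t) c rt => // c; rewrite cr_range.
  have [] := IH _ _ _ _ h; first by rewrite /= k0'.
  by move=> r' ->; split=> //=; rewrite VS // c.
have k1 : (0 < k.-1)%N.
  by case: k {k0 k0' r rt c} h => [|[|k]] //=; case: f {IH}.
have [] := IH _ _ _ _ h; first by rewrite /= i0 k1 /=; case: (t) rt => /=; lia.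
move=> r' ->; split=> //=; rewrite HS //; last by case: (t) rt => /=; lia.
by rewrite prednK //; case: (cr i k) c; case: (t).
Qed.

(** Follow the pipe backwards, up or to the right: [i + (m - k)] decreases until the top row, where
    the label is the column of entry. *)
Lemma trace_complete s : in_range s ->
  (0 < label s <= m)%N /\ s \in trace cr (2 * m + 2) 1 (label s) true.
Proof.
case: s => [[i k] t]; have [N ltN] := ubnP (i + (m - k)); elim: N i k t ltN => // N IH i k t ltN.
move=> r; have [i0 k0 rt] := and3P r.
have step i' k' t' : in_range (i', k', t') -> next (i', k', t') = (i, k, t) ->
    (i' + (m - k') < i + (m - k))%N -> label (i', k', t') = label (i, k, t) ->
    (0 < label (i, k, t) <= m)%N /\ (i, k, t) \in trace cr (2 * m + 2) 1 (label (i, k, t)) true.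
  move=> r' nx lt lb; have [] := IH i' k' t' (leq_trans lt ltN) r'; rewrite lb.
  move: (label (i, k, t)) => lab lm h; split=> //.
  rewrite -nx; apply: trace_next => //; first by rewrite nx; case: (k) k0.
  have [i0' k0' rt'] := and3P r'.
  by case: (t') rt' => /= rt'; lia.
case: t => [|] in r rt step ltN *.
  case: i i0 => // -[|i] _ in r rt step ltN *.
    by rewrite /= V1 ?k0 //; split=> //; rewrite addn2 /= (gtn_eqF k0) mem_head.
  have le : (i.+1 + k <= m)%N by [].
  apply: (step i.+1 k (cr i.+1 k)).
  - by rewrite /= k0; case: (cr _ _); rewrite ?le // ltnW.
  - by rewrite /= eqxx.
  - by [].
  - by rewrite /= [RHS]VS.
apply: (step i k.+1 (~~ cr i k.+1)).
- rewrite /= i0 /=; case c: (cr i k.+1) => /=; last by rewrite addnS.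
  by apply: cr_range.
- by rewrite /=; case: (cr i k.+1).
- by lia.
- by rewrite /= [RHS]HS //; case: (cr i k.+1).
Qed.

Lemma mem_trace s j : (0 < j <= m)%N ->
  (s \in trace cr (2 * m + 2) 1 j true) = in_range s && (label s == j).
Proof.
move=> jm; apply/idP/andP => [h|[r /eqP <-]]; last by have [] := trace_complete r.
have r1 : in_range (1, j, true) by rewrite /=; lia.
by have [r ->] := trace_sound r1 h; split=> //=; rewrite V1.
Qed.

End Trace.

(** * Marked reduced pipe dreams as arrays of tiles *)

Lemma shaped_size n A : shaped n A -> size A = n.
Proof. by elim: n A => [|n IH] [|u A] //= /andP[_ /IH->]. Qed.

Lemma shaped_nth n A k : shaped n A -> (k < n)%N -> size (nth [::] A k) = (n.-1 - k)%N.
Proof.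
elim: n A k => [|n IH] [|u A] [|k] //= /andP[/eqP su sA]; first by rewrite subn0.
by rewrite ltnS => lt; rewrite IH //; lia.
Qed.

Lemma shaped_drop n A k : shaped n A -> shaped (n - k) (drop k A).
Proof.
elim: k n A => [|k IH] n A; first by rewrite subn0 drop0.
by case: n A => [|n] [|u A] //= /andP[_]; apply: IH.
Qed.

Lemma colcross_gt0 u c L a d p : size u = size L -> (p <= size L)%N ->
  reflect (exists q, [/\ (q < p)%N, nth U u q = X & pairX a d (carry u c L q) (nth 0%N L q)])
    (0 < colcross (take p u) c L a d)%N.
Proof.
elim: p u c L => [|p IH] [|l u] c [|y L] //= su lt; try by right=> -[[|q] []].
rewrite addn_gt0 lt0b; apply: (iffP orP) => [[/andP[/eqP-> pX]|]|[[|q] [ltq eX pX]]].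
- by exists 0%N.
- by case: su => su /(IH _ _ _ su lt)[q [ltq eX pX]]; exists q.+1.
- by left; rewrite /= in eX pX; rewrite eX.
- by right; case: su => su; apply/(IH _ _ _ su lt); exists q.
Qed.

Lemma validE u c L : size u = size L ->
  valid u c L <-> Xvalid u c L /\
    (forall p, (p < size L)%N -> nth U u p = M -> (nth 0%N L p < carry u c L p)%N).
Proof.
elim: u c L => [|l u IH] c [|y L] //= [su]; split=> [/and3P[-> /implyP lM v]|[/andP[-> v] vM]].
  have [vX vM] := (IH _ _ su).1 v; rewrite vX; split=> // -[|p] //= lt; last exact: vM.
  by move/eqP.
rewrite (IH _ _ su).2 ?andbT; first by apply/implyP => /eqP; apply: (vM 0%N).
by split=> // p; apply: (vM p.+1).
Qed.

Section Tiles.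
Variables (m : nat) (A : seq (seq letter)).
Hypothesis sA : shaped m A.
Implicit Types (i j k p : nat) (S : pred nat).

Definition tile_at i k : letter := nth U (nth [::] A k.-1) i.-1.
Definition crossings : {set 'I_m * 'I_m} := [set p : 'I_m * 'I_m | tile_at p.1.+1 p.2.+1 == X].
Definition marked : {set 'I_m * 'I_m} := [set p : 'I_m * 'I_m | tile_at p.1.+1 p.2.+1 == M].

(** Tiles are counted from 1 and lists from 0, hence each [.-1]. [Lst k] is the word leaving column
    [k] to the left, so [Lst k.+1] is what enters it; [V i k] and [H i k] are the pipes entering
    tile [(i, k)] from the top and from the right. *)
Let col k := nth [::] A k.-1.
Let Lst k := res (iota k (m.+1 - k)) (drop k.-1 A).
Let V i k := carry (col k) k (Lst k.+1) i.-1.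
Let H i k := nth 0%N (Lst k.+1) i.-1.

Let size_col k : (0 < k <= m)%N -> size (col k) = (m - k)%N.
Proof. by move=> km; rewrite (shaped_nth sA); lia. Qed.

Let perm_Lst k : (0 < k)%N -> perm_eq (Lst k) (iota k (m.+1 - k)).
Proof.
move=> k0; apply: perm_res; rewrite size_iota (_ : m.+1 - k = m - k.-1)%N; last by lia.
exact: shaped_drop.
Qed.

Let size_Lst k : (0 < k)%N -> size (Lst k) = (m.+1 - k)%N.
Proof. by move=> k0; rewrite (perm_sizeN (perm_Lst k0)) size_iota. Qed.

Let size_colL k : (0 < k <= m)%N -> size (col k) = size (Lst k.+1).
Proof. by move=> km; rewrite size_col // size_Lst. Qed.

Let drop_col k : (0 < k <= m)%N -> drop k.-1 A = col k :: drop k A.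
Proof.
by case: k => // k km; rewrite /= (drop_nth [::]) // (shaped_size sA).
Qed.

Let Lst_step k : (0 < k <= m)%N -> Lst k = step (col k) k (Lst k.+1).
Proof.
move=> km; rewrite /Lst drop_col // (_ : m.+1 - k = (m - k).+1)%N; last by lia.
by rewrite /= (_ : m.+1 - k.+1 = m - k)%N.
Qed.

Lemma tile_range i k : (0 < i)%N -> (0 < k)%N -> tile_at i k != U -> (i + k <= m)%N.
Proof.
move=> i0 k0; rewrite /tile_at; case: (ltnP k.-1 m) => [lt|le].
  case: (ltnP i.-1 (size (nth [::] A k.-1))) => [|le]; last by rewrite nth_default.
  by rewrite (shaped_nth sA) //; lia.
by rewrite (nth_default [::]) ?(shaped_size sA) // nth_nil.
Qed.

Let tile_set_in (l : letter) (T : {set 'I_m * 'I_m}) i k : l != U ->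
  T = [set p : 'I_m * 'I_m | tile_at p.1.+1 p.2.+1 == l] ->
  tile_in T i k = [&& (0 < i)%N, (0 < k)%N & tile_at i k == l].
Proof.
move=> lU ->; rewrite /tile_in; case: i => // i; case: k => // k; rewrite /=.
apply/existsP/eqP => [[p]|e].
  by rewrite inE => /and3P[/eqP e /eqP ei /eqP ek]; rewrite -ei -ek.
have := @tile_range i.+1 k.+1 isT isT; rewrite e => /(_ lU) r.
have [im km] : (i < m)%N /\ (k < m)%N by lia.
by exists (Ordinal im, Ordinal km); rewrite inE /= e !eqxx.
Qed.

Lemma in_crossings i k : tile_in crossings i k = [&& (0 < i)%N, (0 < k)%N & tile_at i k == X].
Proof. exact: tile_set_in. Qed.

Lemma in_marked i k : tile_in marked i k = [&& (0 < i)%N, (0 < k)%N & tile_at i k == M].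
Proof. exact: tile_set_in. Qed.

Local Notation cr := (tile_in crossings).

Let cr_range i k : (0 < i)%N -> (0 < k)%N -> cr i k -> (i + k <= m)%N.
Proof.
by move=> i0 k0; rewrite in_crossings i0 k0 /= => /eqP e; apply: tile_range; rewrite // e.
Qed.

Let V1 k : (0 < k <= m)%N -> V 1 k = k. Proof. by move=> _; apply: carry0. Qed.

Let VS i k : (0 < i)%N -> (0 < k)%N -> (i + k <= m)%N ->
  V i.+1 k = if cr i k then V i k else H i k.
Proof.
case: i => // i _ k0 r; rewrite in_crossings k0 /= /V /H /=.
by rewrite carry_S ?size_Lst ?size_col //; lia.
Qed.

Let HS i k : (0 < i)%N -> (0 < k)%N -> (i + k <= m)%N ->
  H i k = if cr i k.+1 then H i k.+1 else V i k.+1.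
Proof.
case: i => // i _ k0 r; rewrite in_crossings /= /V /H /= Lst_step; last by lia.
by rewrite nth_step ?size_Lst ?size_col //; lia.
Qed.

Let mem_pipe s j : (0 < j <= m)%N ->
  (s \in pipe crossings j) = in_range m s && (label V H s == j).
Proof. exact: (mem_trace cr_range V1 VS HS). Qed.

Let label_range s : in_range m s -> (0 < label V H s <= m)%N.
Proof. by case/(trace_complete cr_range V1 VS HS). Qed.

Lemma traversesE j i k : (0 < j <= m)%N -> traverses crossings j i k =
  in_stair m i k && ((V i k == j) || (i + k <= m)%N && (H i k == j)).
Proof.
move=> jm; apply/hasP/andP => [[[[a d] t]]|[st]].
  rewrite mem_pipe // => /andP[r /eqP lb] /= /andP[/eqP ea /eqP ed]; subst a d.
  case/and3P: r lb => i0 k0; case: t => /= r lb; rewrite /in_stair i0 k0 /= lb eqxx r //=.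
  by rewrite orbT leqW.
case/and3P: (st) => i0 k0 r; case/orP=> [/eqP e|/andP[r' /eqP e]].
  by exists (i, k, true); rewrite /= ?eqxx // mem_pipe //= i0 k0 r e eqxx.
by exists (i, k, false); rewrite /= ?eqxx // mem_pipe //= i0 k0 r' e eqxx.
Qed.

Let pipe_mono j i k i' k' : (0 < j <= m)%N -> traverses crossings j i k ->
  traverses crossings j i' k' -> (k < k')%N -> (i' <= i)%N.
Proof.
move=> jm /hasP[[[a d] t] h /andP[/eqP /= ea /eqP /= ed]].
case/hasP=> [[[a' d'] t'] h' /andP[/eqP /= ea' /eqP /= ed']]; subst a d a' d'.
exact: trace_mono h h'.
Qed.

Let memV i k : in_stair m i k -> (0 < V i k <= m)%N.
Proof. exact: (@label_range (i, k, true)). Qed.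

Let memH i k : (0 < i)%N -> (0 < k)%N -> (i + k <= m)%N -> (0 < H i k <= m)%N.
Proof. by move=> i0 k0 r; apply: (@label_range (i, k, false)); rewrite /= i0 k0. Qed.

Let perm_res1 : perm_eq (res (iota 1 m) A) (iota 1 m).
Proof. by apply: perm_res; rewrite size_iota. Qed.

Let Lst1 : Lst 1 = res (iota 1 m) A.
Proof. by rewrite /Lst subn1 drop0. Qed.

Lemma exit_rowE i : (0 < i <= m)%N -> exit_row crossings (nth 0%N (res (iota 1 m) A) i.-1) = i.
Proof.
move=> im; rewrite -Lst1 Lst_step; last by lia.
rewrite nth_step ?size_Lst ?size_col //; try lia.
pose s := (i, 1%N, ~~ cr i 1).
have r : in_range m s.
  have [i0 _] := andP im; rewrite /s /= i0; case c: (cr i 1) => /=; last by lia.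
  exact: cr_range.
have [lm h] := trace_complete cr_range V1 VS HS r.
have ls : label V H s = if nth U (col 1) i.-1 == X then nth 0%N (Lst 2) i.-1 else carry (col 1) 1 (Lst 2) i.-1.
  rewrite /s /= in_crossings /tile_at; case/andP: im => -> _ /=.
  by rewrite /col /=; case: (nth U _ _ == X).
rewrite -ls /exit_row /pipe (trace_last _ h) // /s; by case: (cr i 1).
Qed.

Lemma exit_rows w : perm_eq w (iota 1 m) ->
  all (fun i => exit_row crossings (nth 0%N w i.-1) == i) (rows m) = (res (iota 1 m) A == w).
Proof.
move=> pw; apply/allP/eqP => [h|<- i]; last by rewrite mem_iota => im; rewrite exit_rowE //; lia.
have sw : size w = m by rewrite (perm_sizeN pw) size_iota.
have sr : size (res (iota 1 m) A) = m by rewrite (perm_sizeN perm_res1) size_iota.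
apply: (@eq_from_nth _ 0%N) => [|p]; rewrite ?sw // sr => lt.
have wp : nth 0%N w p \in res (iota 1 m) A.
  by rewrite (perm_mem perm_res1) -(perm_mem pw) mem_nth // sw.
have q := wp; rewrite -index_mem sr in q.
have := h p.+1; rewrite mem_iota /= => /(_ _)/eqP; move: wp q; set y := nth 0%N w p => wp q e2.
have := @exit_rowE (index y (res (iota 1 m) A)).+1; rewrite /= nth_index // e2 => [|//].
by move=> /(_ q)[->]; rewrite nth_index.
Qed.

Let LstS k n : (k + n.+1 = m.+1)%N -> Lst k.+1 = res (iota k.+1 n) (drop k A).
Proof. by move=> e; rewrite /Lst (_ : m.+1 - k.+1 = n)%N //; lia. Qed.

Let tcross_sum a d k n : (0 < k)%N -> (k + n = m.+1)%N ->
  tcross (iota k n) (drop k.-1 A) a d =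
  (\sum_(q <- iota k n) colcross (col q) q (Lst q.+1) a d)%N.
Proof.
elim: n k => [|n IH] k k0 e; first by rewrite big_nil.
rewrite drop_col; last by lia.
by rewrite /= big_cons -(LstS e) -(IH k.+1) // -e; lia.
Qed.

Let good_all S k n : (0 < k)%N -> (k + n = m.+1)%N -> good S (iota k n) (drop k.-1 A) =
  all (fun q => valid (col q) q (Lst q.+1) &&
     (if S q then xu (col q) else okout S false (col q) q (Lst q.+1))) (iota k n).
Proof.
elim: n k => [|n IH] k k0 e //; rewrite drop_col; last by lia.
by rewrite /= -(LstS e) -(IH k.+1) // -?andbA // -e; lia.
Qed.

Let allX_all k n : (0 < k)%N -> (k + n = m.+1)%N -> allX (iota k n) (drop k.-1 A) =
  all (fun q => Xvalid (col q) q (Lst q.+1)) (iota k n).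
Proof.
elim: n k => [|n IH] k k0 e //; rewrite drop_col; last by lia.
by rewrite /= -(LstS e) -(IH k.+1) // -e; lia.
Qed.

Let cross_atE a d i k : (0 < a <= m)%N -> (0 < d <= m)%N -> a != d ->
  cross_at crossings a d i k = cr i k && pairX a d (V i k) (H i k).
Proof.
move=> am dm ad; rewrite /cross_at; case c: (cr i k) => //=.
move: (c); rewrite in_crossings => /and3P[i0 k0 _]; have r := cr_range i0 k0 c.
rewrite !traversesE // /in_stair i0 k0 r (leqW r) /= /pairX.
case: (eqVneq (V i k) a) => [->|_]; case: (eqVneq (H i k) a) => [->|_];
  by rewrite ?(negPf ad) ?orbF ?andbF ?andbT.
Qed.

Let colcross_rows k a d : (0 < k <= m)%N -> (0 < a <= m)%N -> (0 < d <= m)%N -> a != d ->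
  (\sum_(i <- rows m) cross_at crossings a d i k)%N = colcross (col k) k (Lst k.+1) a d.
Proof.
move=> km am dm ad; rewrite colcrossE ?size_colL // size_Lst // subSS.
have -> : rows m = iota 1 (m - k) ++ iota (1 + (m - k)) k.
  by rewrite -iotaD /rows; congr iota; lia.
rewrite big_cat /= [X in (_ + X)%N]big1_seq ?addn0; last first.
  move=> i; rewrite mem_iota /= => im; rewrite cross_atE //; apply/eqP; rewrite eqb0 negb_and.
  by apply/orP; left; apply/negP => c; have := @cr_range i k _ _ c; lia.
rewrite -[1%N]addn0 iotaDl big_map -{1}(subn0 (m - k)%N) -/(index_iota 0 (m - k)) big_mkord.
apply: eq_bigr => p _; rewrite cross_atE // in_crossings add1n /=.
by case/andP: km => ->.
Qed.

Lemma num_crossingsE a d : (0 < a <= m)%N -> (0 < d <= m)%N -> a != d ->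
  num_crossings crossings a d = tcross (iota 1 m) A a d.
Proof.
move=> am dm ad; rewrite -[A in tcross _ A](drop0 A) -[0%N]/(1.-1) tcross_sum // /num_crossings.
rewrite exchange_big /= /cols big_seq [RHS]big_seq; apply: eq_bigr => k.
by rewrite mem_iota => km; apply: colcross_rows => //; lia.
Qed.

Let sorted_iota k n : sorted ltn (iota k n). Proof. exact: iota_ltn_sorted. Qed.

Let shaped1 : shaped (size (iota 1 m)) A. Proof. by rewrite size_iota. Qed.

Lemma num_crossings_le1 :
  all (fun j => all (fun j' => (j != j') ==> (num_crossings crossings j j' <= 1)%N) (pipes m)) (pipes m)
  = allX (iota 1 m) A.
Proof.
have [tX Xt] := tcross_allX (sorted_iota 1 m) shaped1.
have sym a d : num_crossings crossings a d = num_crossings crossings d a.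
  by apply: eq_bigr => i _; apply: eq_bigr => k _; rewrite /cross_at [X in _ && X]andbC.
apply/idP/idP => [h|v]; last first.
  apply/allP => a; rewrite mem_iota => am; apply/allP => d; rewrite mem_iota => dm.
  apply/implyP => ad; case: (ltngtP a d) ad => // lt _.
    by rewrite num_crossingsE ?ltn_eqF // ?tX ?leq_b1 //; lia.
  by rewrite sym num_crossingsE ?ltn_eqF // ?tX ?leq_b1 //; lia.
apply: Xt => a d ad; case am: (a \in iota 1 m); last by rewrite tcross_notin // ?am.
case dm: (d \in iota 1 m); last by rewrite tcross_notin // ?dm ?orbT.
have /allP/(_ _ dm)/implyP := allP h _ am; rewrite ltn_eqF // => /(_ isT).
by rewrite num_crossingsE ?ltn_eqF //; [move: am|move: dm]; rewrite mem_iota; lia.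
Qed.

(** The crossings in the columns to the right are the inversions of the word entering column [k],
    and [colcross_take] follows these down to row [i]. *)
Let crossed i k a d : allX (iota 1 m) A -> (0 < i)%N -> (0 < k)%N -> (i + k <= m)%N -> (a < d)%N ->
  pairX a d (V i k) (H i k) ->
  (colcross (take i.-1 (col k)) k (Lst k.+1) a d + tcross (iota k.+1 (m - k)) (drop k A) a d)%N =
  (V i k == d).
Proof.
move=> v i0 k0 r ad pX; have km : (0 < k <= m)%N by lia.
have ltk : all (ltn k) (Lst k.+1).
  by apply/allP => y; rewrite (perm_mem (perm_Lst _)) // mem_iota => /andP[].
have kL : k \notin Lst k.+1 by apply/negP => /(allP ltk); rewrite /= ltnn.
have UL : uniq (k :: Lst k.+1) by rewrite /= kL (perm_uniq (perm_Lst _)) ?iota_uniq.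
rewrite -(colcross_take (size_colL km) UL ad _ pX); last by rewrite size_Lst //; lia.
congr (_ + _)%N; rewrite inv_cons_min // /Lst subSS.
apply: (tcross_allX (sorted_iota _ _) _).1 ad.
  by rewrite size_iota; apply: shaped_drop.
have := allX_all (ltn0Sn k) (_ : k.+1 + (m - k) = m.+1)%N; rewrite /= => ->; last by lia.
have := allX_all (ltn0Sn 0) (_ : 1 + m = m.+1)%N; rewrite /= drop0 v => /(_ erefl)/esym/allP h.
by apply/allP => q; rewrite mem_iota => qm; apply: h; rewrite mem_iota; lia.
Qed.

Let col_bound i k : (0 < k)%N -> (i + k <= m)%N -> (0 < k <= m)%N.
Proof. by move=> -> /(leq_trans (leq_addl _ _)). Qed.

Let mem_iota1 j : (j \in iota 1 m) = (0 < j <= m)%N.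
Proof. by rewrite mem_iota. Qed.

Let row_bound i k : (0 < i)%N -> (i + k <= m)%N -> (i.-1 < size (Lst k.+1))%N.
Proof. by move=> i0 r; rewrite size_Lst //; lia. Qed.

Let tcross_gt0 k a d : (k <= m)%N ->
  reflect (exists q p, [/\ (k < q <= m)%N, (p < size (Lst q.+1))%N, nth U (col q) p = X &
      pairX a d (carry (col q) q (Lst q.+1) p) (nth 0%N (Lst q.+1) p)])
    (0 < tcross (iota k.+1 (m - k)) (drop k A) a d)%N.
Proof.
move=> km; rewrite -[k in drop k]/(k.+1.-1) tcross_sum //; last by lia.
have colP q : (k < q <= m)%N -> reflect (exists p, [/\ (p < size (Lst q.+1))%N, nth U (col q) p = X &
      pairX a d (carry (col q) q (Lst q.+1) p) (nth 0%N (Lst q.+1) p)])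
    (0 < colcross (col q) q (Lst q.+1) a d)%N.
  move=> kq; have qm : (0 < q <= m)%N by lia.
  rewrite -[X in colcross X](take_size (col q)) size_colL //.
  by apply: colcross_gt0; first exact: size_colL.
have mem q : (q \in iota k.+1 (m - k)) = (k < q <= m)%N by rewrite mem_iota; lia.
apply: (iffP idP) => [|[q [p [kq lt eX pX]]]].
  have [/hasP[q]|/hasPn h] := boolP (has (fun q => 0 < colcross (col q) q (Lst q.+1) a d)%N (iota k.+1 (m - k))).
    by rewrite mem => kq /(colP _ kq)[p [lt eX pX]] _; exists q, p.
  by rewrite big1_seq // => q /= /h; rewrite -eqn0Ngt => /eqP.
rewrite (big_rem q) ?mem //= addn_gt0; apply/orP; left.
by apply/colP => //; exists p.
Qed.

Let cr_col i k : cr i k -> [/\ (0 < i)%N, (0 < k)%N & nth U (col k) i.-1 = X].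
Proof. by rewrite in_crossings => /and3P[-> -> /eqP]. Qed.

(** By [crossed], two pipes meeting at a tile have crossed before exactly when the larger one comes
    from above. An antidiagonal tile meets a single pipe and is excluded. *)
Lemma markableE i k : allX (iota 1 m) A ->
  markable crossings i k =
  [&& in_stair m i k, ~~ cr i k, (i + k <= m)%N & (H i k < V i k)%N].
Proof.
move=> v; rewrite /markable; case st: (in_stair m i k) => //=; case c: (cr i k) => //=.
have [i0 k0 r] := and3P st.
apply/hasP/andP => [[j]|[r' ltHV]].
  rewrite mem_iota1 => jm /hasP[j']; rewrite mem_iota1 => jm' /and4P[jj tj tj'].
  case/hasP=> i' _ /hasP[k' _ /andP[lti]].
  rewrite cross_atE // => /andP[c' pX'].
  have [i0' k0' eX'] := cr_col c'; have r2 := cr_range i0' k0' c'.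
  have tj2 : traverses crossings j i' k'.
    rewrite traversesE // /in_stair i0' k0' (leqW r2) r2 /=.
    by case/orP: pX' => /andP[e1 e2]; rewrite ?e1 ?e2 ?orbT.
  (* A pipe only descends as it moves left, so a crossing strictly above row [i] lies in column [k]
     or further right, where [crossed] counts it. *)
  have le : (k <= k')%N by rewrite leqNgt; apply/negP => /(pipe_mono jm tj2 tj); rewrite leqNgt lti.
  have r' : (i + k <= m)%N.
    move: tj tj'; rewrite !traversesE // st /=; case: (leqP (i + k)%N m) => // _.
    by rewrite !orbF => /eqP-> /eqP e; rewrite e eqxx in jj.
  have km := col_bound k0 r'; split=> //.
  have pX : pairX j j' (V i k) (H i k).
    move: tj tj' jj; rewrite !traversesE // st r' /= /pairX.
    by do 2 case/orP=> /eqP->; rewrite ?eqxx ?orbT //= => /eqP[].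
  have main a d : (a < d)%N -> (0 < a <= m)%N -> (0 < d <= m)%N -> pairX a d (V i k) (H i k) ->
      pairX a d (V i' k') (H i' k') -> (H i k < V i k)%N.
    move=> ad am dm p p'; suff /eqP e : V i k == d.
      by move: p; rewrite /pairX e (gtn_eqF ad) /= => /andP[_ /eqP->].
    rewrite -[V i k == d]lt0b -(crossed v i0 k0 r' ad p) addn_gt0.
    move: le; rewrite leq_eqVlt => /predU1P[ek|ltk]; apply/orP; [left|right].
      subst k'; apply/colcross_gt0; [exact: size_colL km|exact: ltnW (row_bound i0 r')|].
      by exists i'.-1; split=> //; rewrite -ltnS !prednK.
    apply/tcross_gt0; first by case/andP: km.
    exists k', i'.-1; split=> //; last exact: row_bound.
    by rewrite ltk; case/andP: (col_bound k0' r2).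
  case: (ltngtP j j') jj => // lt _; first exact: (main j j').
  by apply: (main j' j) => //; rewrite /pairX orbC.
have hm := memH i0 k0 r'; have vm := memV st.
have pX : pairX (H i k) (V i k) (V i k) (H i k) by rewrite /pairX !eqxx orbT.
have tV : traverses crossings (V i k) i k by rewrite traversesE // st eqxx.
have tH : traverses crossings (H i k) i k by rewrite traversesE // st r' eqxx orbT.
suff [i' [k' [lti c' pX']]] : exists i' k', [/\ (i' < i)%N, cr i' k' &
    pairX (H i k) (V i k) (V i' k') (H i' k')].
  have [i0' k0' _] := cr_col c'; have r2 := cr_range i0' k0' c'.
  exists (H i k); first by rewrite mem_iota1.
  apply/hasP; exists (V i k); first by rewrite mem_iota1.
  rewrite (ltn_eqF ltHV) tH tV /=; apply/hasP; exists i'.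
    by rewrite mem_iota1 i0' (leq_trans (leq_addr _ _) r2).
  apply/hasP; exists k'; first by rewrite mem_iota1 (col_bound k0' r2).
  by rewrite lti cross_atE ?(ltn_eqF ltHV) // c'.
have km := col_bound k0 r'.
have /esym := crossed v i0 k0 r' ltHV pX; rewrite eqxx => e.
have: (0 < nat_of_bool true)%N by []; rewrite {}e addn_gt0 => /orP[|].
  case/colcross_gt0; [exact: size_colL|exact: ltnW (row_bound i0 r')|].
  move=> q [ltq eX pX']; exists q.+1, k; split=> //; first by rewrite -[i]prednK.
  by rewrite in_crossings k0 /= /tile_at -/(col k) eX.
case/tcross_gt0; first by case/andP: km.
move=> k' [q [/andP[ltk k'm] ltq eX pX']]; have k0' := ltn_trans k0 ltk.
have c' : cr q.+1 k' by rewrite in_crossings /tile_at -/(col k') eX k0'.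
exists q.+1, k'; split=> //.
have r2 := cr_range (ltn0Sn q) k0' c'.
have st3 : in_stair m q.+2 k' by rewrite /in_stair k0' addSn ltnS.
have [j [jm tj Vj]] : exists j, [/\ (0 < j <= m)%N, traverses crossings j i k & V q.+1 k' = j].
  by case/orP: pX' => /andP[/eqP e _]; [exists (H i k)|exists (V i k)].
(* The carried pipe goes straight down through the crossing and also traverses the tile below it, in
   row [q.+2]. That row is at most [i], so the crossing is strictly above. *)
apply: (pipe_mono jm tj (i' := q.+2) (k' := k')) => //.
by rewrite traversesE // st3 VS // c' Vj eqxx.
Qed.

Let travE j i k : (0 < j <= m)%N -> (0 < i)%N -> (0 < k)%N -> (i + k <= m)%N ->
  traverses crossings j i k = (V i k == j) || (H i k == j).
Proof. by move=> jm i0 k0 r; rewrite traversesE // /in_stair i0 k0 leqW // r. Qed.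

Let unmarked_bumpE i k :
  unmarked_bump crossings marked i k = in_stair m i k && (tile_at i k == U).
Proof.
rewrite /unmarked_bump; case st: (in_stair m i k) => //=.
have [i0 k0 _] := and3P st; rewrite in_crossings in_marked i0 k0 /=.
by case: (tile_at i k) => [[]|].
Qed.

Let size_LstS k : (k <= m)%N -> size (Lst k.+1) = (m - k)%N.
Proof. by move=> km; rewrite size_Lst // subSS. Qed.

Let unobs_tiles j : (0 < j <= m)%N ->
  all (fun i => all (fun k => (tile_in crossings i k && traverses crossings j i k && (1 < i)%N) ==>
    ~~ unmarked_bump crossings marked i.-1 k) (cols m)) (rows m) &&
  all (fun i => all (fun k => (tile_in marked i k && ~~ tile_in crossings i k) ==>
    ~~ traverses crossings j i k) (cols m)) (rows m) =
  all (fun q => unobs (pred1 j) false (col q) q (Lst q.+1)) (iota 1 m).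
Proof.
move=> jm; apply/andP/allP => [[/allP h2 /allP h3] q|h].
  rewrite mem_iota1 => qm; have [q0 qm'] := andP qm.
  apply/unobsP; first exact: size_colL.
  move=> p lt; rewrite size_LstS // in lt.
  have r : (p.+1 + q <= m)%N by lia.
  have pm : p.+1 \in rows m by rewrite mem_iota1 /= (leq_trans (leq_addr q _)).
  have qm1 : q \in cols m by rewrite mem_iota1.
  have t2 := allP (h2 _ pm) _ qm1; have t3 := allP (h3 _ pm) _ qm1.
  move: t2 t3; rewrite !in_crossings !in_marked q0 /= travE // unmarked_bumpE /tile_at /= -/(col q).
  move=> t2 t3; split=> e; move: t2 t3; rewrite e /=.
    move=> t2 _ p0 eU; move: t2; rewrite eU eqxx ltnS p0 /in_stair p0 q0 /= andbT.
    by rewrite (leq_trans _ (leqW r)) ?implybF ?negb_or; [case/andP|rewrite leq_add2r].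
  by move=> _; rewrite negb_or => /andP.
split; apply/allP => i _; apply/allP => k km1; apply/implyP.
  case/andP=> /andP[c tj] i1; rewrite unmarked_bumpE; apply/negP => /andP[_ /eqP eU].
  have [i0 k0 eX] := cr_col c; have r := cr_range i0 k0 c.
  have km := col_bound k0 r; move: tj; rewrite travE //.
  have /h/(unobsP _ _ (size_colL km))/(_ i.-1) : k \in iota 1 m by rewrite mem_iota1.
  case/(_ (row_bound i0 r))=> /(_ eX) nX _.
  have [||/negPf nV /negPf nH] := nX; [by rewrite -ltnS prednK|exact: eU|].
  by move: nV nH; rewrite /= /V /H => -> ->.
rewrite in_marked => /andP[/and3P[i0 k0 /eqP eM] _].
have r : (i + k <= m)%N by apply: tile_range; rewrite // eM.
have km := col_bound k0 r; rewrite travE //.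
have /h/(unobsP _ _ (size_colL km))/(_ i.-1) : k \in iota 1 m by rewrite mem_iota1.
by case/(_ (row_bound i0 r))=> _ /(_ eM) [nV nH]; apply/norP.
Qed.

Let xu_tiles j : (0 < j <= m)%N ->
  has (fun r => all (fun i =>
      ((i <= r)%N ==> tile_in crossings i j && traverses crossings j i j) &&
      ((r < i)%N ==> unmarked_bump crossings marked i j)) (iota 1 (m.+1 - j))) (iota 0 m.+1) =
  xu (col j).
Proof.
move=> jm; have [j0 jm'] := andP jm; apply/hasP/xuP => [[r _ /allP h]|[r h]].
  exists r => p; rewrite size_col // => lt.
  have pr : p.+1 \in iota 1 (m.+1 - j) by rewrite mem_iota; lia.
  have := h _ pr; rewrite in_crossings unmarked_bumpE /tile_at /= -/(col j).
  case: ltnP => rp /andP[h1 h2]; first by move: h1 => /= /andP[/andP[_ /eqP]].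
  by move: h2; rewrite ?ltnS ?rp /= => /andP[_ /eqP].
(* The bottom tile, in row [m.+1 - j], is a bump absent from the column word, so the number of
   crossings is capped at [m - j]. *)
exists (minn r (m - j)); first by rewrite mem_iota; lia.
apply/allP => i; rewrite mem_iota => im.
have st : in_stair m i j by rewrite /in_stair; lia.
have i0 : (0 < i)%N by case/andP: im.
apply/andP; split; apply/implyP => ir.
  have rng : (i + j <= m)%N by lia.
  have eX q : (q < i)%N -> nth U (col j) q = X.
    by move=> qi; rewrite h; [rewrite ifT //|rewrite size_col //]; lia.
  rewrite in_crossings i0 j0 /tile_at -/(col j) eX ?prednK //= travE //.
  by rewrite /V carry_prefix ?eqxx // => q qi; apply: eX; rewrite (leq_trans qi) // leq_pred.
rewrite unmarked_bumpE st /tile_at -/(col j).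
case: (ltnP i.-1 (size (col j))) => [lt|le]; last by rewrite nth_default.
by rewrite h // ifF //; rewrite size_col // in lt; lia.
Qed.

(** Conditions (ii) and (iii) concern one pipe at a time, so those of all of [S] combine tile by
    tile into [unobs S]. Columns in [S] satisfy them automatically by [xu_unobs]. *)
Lemma removable_unobs S :
  all (fun j => S j ==> removable crossings marked j) (pipes m) =
  all (fun q => if S q then xu (col q) else okout S false (col q) q (Lst q.+1)) (iota 1 m).
Proof.
have remE j : (0 < j <= m)%N -> removable crossings marked j =
    xu (col j) && all (fun q => unobs (pred1 j) false (col q) q (Lst q.+1)) (iota 1 m).
  by move=> jm; rewrite /removable xu_tiles // unobs_tiles.
apply/allP/allP => h q qm; have := qm; rewrite mem_iota1 => qm'; have sq := size_colL qm'.
  case: ifP => Sq; first by have := h _ qm; rewrite Sq remE // => /andP[].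
  rewrite -unobs_ok ?Sq //; apply/unobsP => // p lt.
  have nS y : (0 < y <= m)%N -> S y -> unobstructed (pred1 y) (col q) q (Lst q.+1) p.
    move=> ym Sy; have /implyP/(_ Sy) := h y (etrans (mem_iota1 y) ym).
    by rewrite remE // => /andP[_ /allP/(_ _ qm)/unobsP]; apply.
  have r : (p.+1 + q <= m)%N by case/andP: qm' lt => _ km; rewrite size_LstS //; lia.
  have st : in_stair m p.+1 q by rewrite /in_stair (leqW r) andbT; case/andP: qm'.
  have q0 : (0 < q)%N by case/andP: qm'.
  have vm := memV st; have hm := memH (ltn0Sn p) q0 r.
  split=> [eX p0 eU|eM]; split; apply/negP => Sy.
  - by have [/(_ eX p0 eU)[/=]] := nS _ vm Sy; rewrite /V eqxx.
  - by have [/(_ eX p0 eU)[_ /=]] := nS _ hm Sy; rewrite /H eqxx.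
  - by have [_ /(_ eM)[/=]] := nS _ vm Sy; rewrite /V eqxx.
  - by have [_ /(_ eM)[_ /=]] := nS _ hm Sy; rewrite /H eqxx.
apply/implyP => Sq; rewrite remE //; have := h _ qm; rewrite Sq => xq; rewrite xq.
apply/allP => k km; have := km; rewrite mem_iota1 => km'; have sk := size_colL km'.
have := h _ km; case: ifP => [Sk xk|/negbT Sk]; first exact: xu_unobs.
rewrite -unobs_ok // => /(unobsP _ _ sk) u; apply/unobsP => // p lt.
have sub y : ~~ S y -> ~~ pred1 q y by apply: contraNN => /eqP->.
by have [uX uM] := u p lt; split=> [eX p0 eU|eM]; [have [] := uX eX p0 eU|have [] := uM eM]; split; apply: sub.
Qed.

Theorem MRPD_good S w : perm_eq w (iota 1 m) ->
  MRPD w crossings marked && all (fun j => S j ==> removable crossings marked j) (pipes m) =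
  good S (iota 1 m) A && (res (iota 1 m) A == w).
Proof.
move=> pw; rewrite /MRPD /reduced_for num_crossings_le1 exit_rows //.
have -> : [forall p in crossings, (p.1.+1 + p.2.+1 <= m)%N].
  by apply/forall_inP => p; rewrite inE => /eqP e; apply: tile_range; rewrite // e.
have -> : [forall p in marked, p \notin crossings].
  by apply/forall_inP => p; rewrite !inE => /eqP->.
rewrite removable_unobs; have := good_all S (ltn0Sn 0) (_ : 1 + m = m.+1)%N.
rewrite /= drop0 => -> //; have := allX_all (ltn0Sn 0) (_ : 1 + m = m.+1)%N.
rewrite /= drop0 => /(_ erefl) aX; case: (res _ A == w); last by rewrite !andbF.
rewrite !andbT all_predI /= aX; congr (_ && _); rewrite -aX; apply/andP/allP => [[v /forall_inP h] q qm|h].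
  have := v; rewrite aX => /allP/(_ _ qm) vX; have := qm; rewrite mem_iota1 => qm'; have [q0 _] := andP qm'.
  apply/(validE _ (size_colL qm')); split=> // p lt eM.
  have r : (p.+1 + q <= m)%N by case/andP: qm' lt => _ km; rewrite size_LstS //; lia.
  have [pm qm1] : (p < m)%N /\ (q.-1 < m)%N by lia.
  have := h (Ordinal pm, Ordinal qm1); rewrite inE /= prednK // /tile_at /= -/(col q) eM eqxx => /(_ isT).
  by rewrite markableE // => /and4P[].
have v : allX (iota 1 m) A.
  rewrite aX; apply/allP => q qm; have := qm; rewrite mem_iota1 => /size_colL sq.
  by have /(validE _ sq)[] := h q qm.
split=> //; apply/forall_inP => -[p q]; rewrite inE => /eqP eM.
have r : (p.+1 + q.+1 <= m)%N by apply: tile_range; rewrite // eM.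
have qm := col_bound (ltn0Sn q) r.
rewrite markableE // in_crossings /= eM r /= /in_stair /= (leqW r) /=.
have /h/(validE _ (size_colL qm))[_] : q.+1 \in iota 1 m by rewrite mem_iota1.
by apply=> //; apply: (row_bound (ltn0Sn p) r).
Qed.

End Tiles.

(** * Decoding pairs of cell sets into arrays *)

Lemma tile_in_ord m (C : {set 'I_m * 'I_m}) (p : 'I_m * 'I_m) :
  tile_in C p.1.+1 p.2.+1 = (p \in C).
Proof.
rewrite /tile_in /=; apply/existsP/idP => [[q /and3P[qC /eqP e1 /eqP e2]]|pC].
  by rewrite [p]surjective_pairing -(val_inj e1) -(val_inj e2) -surjective_pairing.
by exists p; rewrite pC !eqxx.
Qed.

Lemma shaped_from_nth n A : size A = n ->
  (forall k, (k < n)%N -> size (nth [::] A k) = (n.-1 - k)%N) -> shaped n A.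
Proof.
elim: n A => [|n IH] [|u A] //= [sA] h; apply/andP; split.
  by apply/eqP; have := h 0%N isT; rewrite subn0.
by apply: IH => // k lt; have := h k.+1 lt; rewrite /= => ->; lia.
Qed.

Section Decode.
Variable m : nat.
Implicit Types C N : {set 'I_m * 'I_m}.

Definition decode C N : seq (seq letter) :=
  [seq [seq if tile_in C i k then X else if tile_in N i k then M else U | i <- iota 1 (m - k)]
  | k <- iota 1 m].

Lemma decode_shaped C N : shaped m (decode C N).
Proof.
apply: shaped_from_nth => [|k lt]; first by rewrite size_map size_iota.
by rewrite (nth_map 0%N) ?size_iota // size_map size_iota nth_iota //; lia.
Qed.

Lemma tile_decode C N i k : (0 < i)%N -> (0 < k)%N -> (i + k <= m)%N ->
  tile_at (decode C N) i k = if tile_in C i k then X else if tile_in N i k then M else U.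
Proof.
move=> i0 k0 r; rewrite /tile_at (nth_map 0%N) ?size_iota; last by lia.
rewrite nth_iota; last by lia.
rewrite (nth_map 0%N) ?size_iota; last by lia.
by rewrite nth_iota ?add1n ?prednK //; lia.
Qed.

Lemma crossings_decode C N : [forall p in C, (p.1.+1 + p.2.+1 <= m)%N] ->
  crossings m (decode C N) = C.
Proof.
move/forall_inP => r; apply/setP => p; rewrite inE.
case: (leqP (p.1.+1 + p.2.+1) m) => [le|gt].
  by rewrite tile_decode // !tile_in_ord; case: (p \in C) => //; case: (p \in N).
rewrite [RHS](_ : _ = false); last by apply/negP => /r; rewrite leqNgt gt.
apply/eqP => e; have := tile_range (decode_shaped C N) (ltn0Sn p.1) (ltn0Sn p.2).
by rewrite e leqNgt gt => /(_ isT).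
Qed.

Lemma marked_decode C N : [forall p in N, (p.1.+1 + p.2.+1 <= m)%N] ->
  [forall p in N, p \notin C] -> marked m (decode C N) = N.
Proof.
move=> /forall_inP r /forall_inP d; apply/setP => p; rewrite inE.
case: (leqP (p.1.+1 + p.2.+1) m) => [le|gt].
  rewrite tile_decode // !tile_in_ord; case pN: (p \in N); last by case: (p \in C).
  by rewrite (negPf (d _ pN)).
rewrite [RHS](_ : _ = false); last by apply/negP => /r; rewrite leqNgt gt.
apply/eqP => e; have := tile_range (decode_shaped C N) (ltn0Sn p.1) (ltn0Sn p.2).
by rewrite e leqNgt gt => /(_ isT).
Qed.

Lemma encode_inj A B : shaped m A -> shaped m B -> crossings m A = crossings m B ->
  marked m A = marked m B -> A = B.
Proof.
move=> sA sB /setP eC /setP eM.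
have e (p : 'I_m * 'I_m) : tile_at A p.1.+1 p.2.+1 = tile_at B p.1.+1 p.2.+1.
  by have := eC p; have := eM p; rewrite !inE; case: (tile_at A _ _) => [[]|]; case: (tile_at B _ _) => [[]|].
apply: (@eq_from_nth _ [::]) => [|k]; first by rewrite (shaped_size sA) (shaped_size sB).
rewrite (shaped_size sA) => km; apply: (@eq_from_nth _ U) => [|i].
  by rewrite (shaped_nth sA) // (shaped_nth sB).
rewrite (shaped_nth sA) // => lt; have im : (i < m)%N by lia.
exact: (e (Ordinal im, Ordinal km)).
Qed.

Lemma count_nth (u : seq letter) n : (size u <= n)%N ->
  marks u = (\sum_(i < n) (nth U u i == M))%N.
Proof.
elim: u n => [|l u IH] n le; first by rewrite big1 // => i _; rewrite nth_nil.
by case: n le => // n le; rewrite big_ord_recl /= -IH.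
Qed.

Lemma nmarks_card A : shaped m A -> nmarks A = #|marked m A|.
Proof.
move=> sA; rewrite /nmarks sumnE big_map (big_nth [::]) big_mkord (shaped_size sA).
rewrite -sum1_card (eq_bigr (fun k : 'I_m => \sum_(i < m) (nth U (nth [::] A k) i == M))%N); last first.
  by move=> k _; apply: count_nth; rewrite (shaped_nth sA) //; have := ltn_ord k; lia.
rewrite exchange_big pair_bigA /= [RHS]big_mkcond; apply: eq_bigr => p _.
by rewrite inE /tile_at; case: eqP.
Qed.

Theorem sum_MRPD (S : pred nat) (R : comNzRingType) (b : R) w : perm_eq w (iota 1 m) ->
  \sum_(P : {set 'I_m * 'I_m} * {set 'I_m * 'I_m} |
      MRPD w P.1 P.2 && all (fun j => S j ==> removable P.1 P.2 j) (pipes m)) b ^+ #|P.2| =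
  ssum b S (iota 1 m) w.
Proof.
move=> pw; rewrite (ssum_arrays _ _ _ (iota_ltn_sorted 1 m)) size_iota.
pose enc A := (crossings m A, marked m A); rewrite [LHS]big_mkcond.
pose G (P : {set 'I_m * 'I_m} * {set 'I_m * 'I_m}) : R := if MRPD w P.1 P.2 &&
  all (fun j => S j ==> removable P.1 P.2 j) (pipes m) then b ^+ #|P.2| else 0.
transitivity (\sum_(P <- map enc (arrays m)) G P); last first.
  rewrite big_map big_seq [RHS]big_seq; apply: eq_bigr => A; rewrite mem_arrays => sA.
  by rewrite /G /enc /= MRPD_good // nmarks_card //; case: ifP; rewrite ?mul1r ?mul0r.
rewrite [RHS]big_uniq; last first.
  rewrite map_inj_in_uniq ?arrays_uniq // => A B; rewrite !mem_arrays => sA sB [].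
  exact: encode_inj.
rewrite [RHS]big_mkcond; apply: eq_bigr => -[C N] _; rewrite /G /=.
case: ifP => [/andP[mr _]|_]; last by rewrite if_same.
rewrite ifT //.
case/and3P: mr => red dis /forall_inP mk.
have [rC nc _] := and3P red; have sD := decode_shaped C N.
have cD := crossings_decode N rC.
have aX : allX (iota 1 m) (decode C N) by rewrite -num_crossings_le1 // cD.
(* Arrays have no room for marks on or below the antidiagonal; markability excludes them, so every
   marked reduced pipe dream is in the image of [enc]. *)
have rN : [forall p in N, (p.1.+1 + p.2.+1 <= m)%N].
  by apply/forall_inP => p /mk; rewrite -cD markableE // => /and4P[].
apply/mapP; exists (decode C N); first by rewrite mem_arrays.
by rewrite /enc cD marked_decode.
Qed.

End Decode.

(** * Standardization and inclusion-exclusion *)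

Section Standardization.
Implicit Types (v w p V : seq nat) (s t : bitseq).

Let rank v x := count (fun y => (y <= x)%N) v.

Lemma std_map (f : nat -> nat) v : {in v &, forall x y, (f x < f y)%N = (x < y)%N} ->
  std (map f v) = std v.
Proof.
move=> fm; rewrite /std -map_comp; apply/eq_in_map => x xv /=.
by rewrite count_map; apply: eq_in_count => y yv /=; rewrite leqNgt fm // -leqNgt.
Qed.

Lemma rank_lt v : {in v &, forall x y, (rank v x < rank v y)%N = (x < y)%N}.
Proof.
move=> x y xv yv; case: (ltnP x y) => [lt|le]; last first.
  by apply/negbTE; rewrite -leqNgt; apply: sub_count => z /= zy; apply: leq_trans le.
have -> : rank v y = (rank v x + count (fun z => x < z <= y)%N v)%N.
  rewrite /rank -count_predUI [X in (_ + X)%N](eq_count (a2 := pred0)) ?count_pred0 ?addn0; last first.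
    by move=> z /=; lia.
  by apply: eq_count => z /=; lia.
rewrite -[X in (X < _)%N]addn0 ltn_add2l -has_count; apply/hasP; exists y => //.
by rewrite lt leqnn.
Qed.

Lemma std_is_perm v : uniq v -> is_perm (std v).
Proof.
move=> Uv; rewrite /is_perm size_map.
have Us : uniq (std v).
  rewrite map_inj_in_uniq // => x y xv yv e.
  by have := rank_lt xv yv; have := rank_lt yv xv; rewrite /rank e ltnn; case: (ltngtP x y).
have sub : {subset std v <= iota 1 (size v)}.
  move=> _ /mapP[x xv ->]; rewrite mem_iota -has_count ltnS count_size andbT.
  by apply/hasP; exists x => /=.
have [|_ e] := uniq_min_size Us sub; first by rewrite size_iota size_map.
by apply: uniq_perm; rewrite ?iota_uniq.
Qed.

Lemma std_id w : is_perm w -> std w = w.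
Proof.
move=> pw; rewrite -[RHS]map_id; apply/eq_in_map => x; rewrite (perm_mem pw) mem_iota => xw.
rewrite (seq.permP pw) (eq_in_count (a2 := fun y => y < 1 + x)%N); last by move=> y _ /=; rewrite add1n ltnS.
have -> : iota 1 (size w) = iota 1 x ++ iota (1 + x) (size w - x) by rewrite -iotaD; congr iota; lia.
rewrite count_cat (eq_in_count (a2 := predT)) ?count_predT ?size_iota; last first.
  by move=> y; rewrite mem_iota => /andP[_ ->].
rewrite (eq_in_count (a2 := pred0)) ?count_pred0 ?addn0 // => y.
by rewrite mem_iota => /andP[le _]; rewrite ltnNge le.
Qed.

Lemma std_mask_std t v : uniq v -> std (mask t (std v)) = std (mask t v).
Proof.
move=> Uv; rewrite {2}/std -map_mask std_map // => x y xt yt.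
by apply: rank_lt; apply: mem_mask; eassumption.
Qed.

Lemma avoids_std_mask w p t : uniq w -> avoids w p -> avoids (std (mask t w)) p.
Proof.
move=> Uw av [t' e]; apply: av.
have Um : uniq (mask t w) by apply: mask_uniq.
rewrite std_mask_std // in e.
have : subseq (mask t' (mask t w)) w by apply: subseq_trans (mask_subseq _ _) (mask_subseq _ _).
case/subseqP=> t2 st2 e2; have st2' : size t2 == size w by apply/eqP.
by exists (Tuple st2'); rewrite /= -e2.
Qed.

Lemma no_1423_avoids S w : avoids w [:: 1; 4; 2; 3]%N -> no_1423 S w.
Proof.
move=> av p a j c /subseqP[t st e] _; apply/negP => /and3P[pj jc ca]; apply: av.
have st' : size t == size w by apply/eqP.
exists (Tuple st'); rewrite /= -e /std /= !leqnn.
have E (y z : nat) : (y < z)%N -> ((y <= z)%N = true) * ((z <= y)%N = false).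
  by move=> lt; rewrite ltnW // leqNgt lt.
have pc := ltn_trans pj jc; have ja := ltn_trans jc ca; have pa := ltn_trans pj ja.
by rewrite !(E _ _ pj) !(E _ _ jc) !(E _ _ ca) !(E _ _ pc) !(E _ _ ja) !(E _ _ pa).
Qed.

Variables (R : comNzRingType) (b : R) (x : nat -> R).

(** Letters enter [pdsum] only through comparisons. This reconciles words with deleted values, which
    keep their letters, with [Upsilon], defined on standardized ones. *)
Lemma pdsum_map (f : nat -> nat) V w : {in V &, forall x y, (f x < f y)%N = (x < y)%N} ->
  perm_eq w V -> pdsum b x (map f V) (map f w) = pdsum b x V w.
Proof.
have tmap (i : nat) (g h : seq nat -> R) (O : seq nat) : {in O &, forall x y, (f x < f y)%N = (x < y)%N} ->
    (forall Y, perm_eq Y O -> g (map f Y) = h Y) -> transfer b x i g (map f O) = transfer b x i h O.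
  elim: O i g h => [|o O IH] i g h fm e /=; first exact: (e [::]).
  apply: IH => [y z yO zO|Y pY]; first by apply: fm; rewrite inE ?yO ?zO orbT.
  rewrite /tile (e (o :: Y)) ?perm_cons //; case: Y pY => // y L pY.
  rewrite /= fm ?mem_head // ?inE -?(perm_mem pY) ?mem_head ?orbT //.
  by rewrite (e (y :: o :: L)) // perm_insert2.
elim: V w => [|k V IH] w fm pw /=; first by case: w {pw}.
have fw : {in w &, forall x y, (f x < f y)%N = (x < y)%N}.
  by move=> y z; rewrite !(perm_mem pw); apply: fm.
apply: tmap => // -[|y L] pY //=.
have yV : y \in k :: V by rewrite -(perm_mem pw) -(perm_mem pY) mem_head.
have -> : (f y == f k) = (y == k).
  apply/eqP/eqP => [e|-> //].
  by have := fm y k yV (mem_head _ _); have := fm k y (mem_head _ _) yV; rewrite e ltnn; case: (ltngtP y k).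
case: eqP => // yk; apply: IH => [z z' zV zV'|]; first by apply: fm; rewrite inE ?zV ?zV' orbT.
by have := perm_trans pY pw; rewrite yk perm_cons.
Qed.

End Standardization.

Lemma Upsilon_std V v : sorted ltn V -> perm_eq v V ->
  Upsilon (std v) = pdsum beta (fun _ => 1) V v.
Proof.
move=> sV pv; have UV : uniq V by rewrite (sorted_uniq ltn_trans ltnn).
have Uv : uniq v by rewrite (perm_uniq pv).
rewrite Upsilon_pdsum ?std_is_perm // size_map.
have lt : {in V &, forall x y, (count (fun z => z <= x) v < count (fun z => z <= y) v)%N = (x < y)%N}.
  by move=> x y; rewrite -!(perm_mem pv); apply: rank_lt.
rewrite -(pdsum_map _ _ lt pv); congr pdsum.
apply: (sorted_eq ltn_trans); [by move=> y z /= /andP[]; lia|exact: iota_ltn_sorted| |].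
  rewrite sorted_map; apply: sub_in_sorted sV; last exact: allss.
  by move=> y z yV zV /=; rewrite lt.
have := std_is_perm Uv; rewrite /is_perm size_map perm_sym => h; rewrite perm_sym.
apply: perm_trans (_ : perm_eq _ (std v)) _; last by rewrite perm_sym.
by rewrite /std; apply: perm_map; rewrite perm_sym.
Qed.

Fixpoint bitseqs n : seq bitseq :=
  if n is n'.+1 then map (cons true) (bitseqs n') ++ map (cons false) (bitseqs n') else [:: [::]].

Lemma mem_bitseqs n s : (s \in bitseqs n) = (size s == n).
Proof.
elim: n s => [|n IH] s; first by rewrite inE size_eq0.
rewrite mem_cat; apply/orP/idP => [[]/mapP[s' h ->]|]; rewrite ?eqSS -?IH //.
case: s => // -[] s; rewrite eqSS -IH => h; [left|right]; exact: map_f.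
Qed.

Lemma bitseqs_uniq n : uniq (bitseqs n).
Proof.
elim: n => //= n IH; rewrite cat_uniq !map_inj_uniq ?IH //=; try by move=> ? ? [].
by rewrite andbT; apply/hasPn => _ /mapP[s _ ->]; apply/mapP => -[].
Qed.

Lemma sum_tuple (R : nmodType) n (F : bitseq -> R) :
  \sum_(t : n.-tuple bool) F t = \sum_(s <- bitseqs n) F s.
Proof.
rewrite -(big_map val xpredT F); apply: perm_big; apply: uniq_perm.
- by rewrite map_inj_uniq ?index_enum_uniq //; apply: val_inj.
- exact: bitseqs_uniq.
move=> s; rewrite mem_bitseqs; apply/mapP/eqP => [[t _ ->]|/eqP h]; first exact: size_tuple.
by exists (Tuple h) => //; rewrite mem_index_enum.
Qed.

Lemma big_bitseqs (R : nmodType) n (F : bitseq -> R) : \sum_(s <- bitseqs n.+1) F s =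
  \sum_(s <- bitseqs n) F (true :: s) + \sum_(s <- bitseqs n) F (false :: s).
Proof. by rewrite big_cat !big_map. Qed.

Section Inversion.
Variables (R : comNzRingType) (T : Type).
Implicit Types (g : seq T -> R) (v w : seq T).

Definition altsum g v := \sum_(s <- bitseqs (size v)) (-1) ^+ count negb s * g (mask s v).

Lemma altsum_cons g x v : altsum g (x :: v) = altsum (fun u => g (x :: u)) v - altsum g v.
Proof.
rewrite /altsum /= big_cat !big_map /= -sumrN; congr (_ + _).
by apply: eq_bigr => s _; rewrite exprS mulN1r mulNr.
Qed.

(** Pair the masks that keep and drop the first letter: by [altsum_cons] the term without it
    cancels, leaving the same sum for the tail. *)
Lemma sum_altsum g w : \sum_(s <- bitseqs (size w)) altsum g (mask s w) = g w.
Proof.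
elim: w g => [|x w IH] g; first by rewrite big_seq1 /altsum big_seq1 /= expr0 mul1r.
rewrite [size _]/= big_bitseqs /= -big_split /= -(IH (fun u => g (x :: u))).
by apply: eq_bigr => s _; rewrite altsum_cons subrK.
Qed.

(** Inclusion-exclusion over the deleted letters: if [q] holds for some letter, keeping and deleting
    it cancel. *)
Lemma altsum_all (q : pred T) v :
  \sum_(s <- bitseqs (size v)) (-1) ^+ count negb s * (all q (mask (map negb s) v))%:R =
  (all (predC q) v)%:R :> R.
Proof.
elim: v => [|x v IH]; first by rewrite big_seq1 mulr1.
rewrite [size _]/= big_bitseqs /= IH; case: (q x) => /=; last first.
  by rewrite [X in _ + X]big1 ?addr0 // => s _; rewrite mulr0.
rewrite (eq_bigr (fun s => - ((-1) ^+ count negb s * (all q (mask (map negb s) v))%:R))).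
  by rewrite sumrN IH subrr.
by move=> s _; rewrite exprS mulN1r mulNr.
Qed.

End Inversion.

Lemma signed_sum (g : seq nat -> ZB) v :
  \sum_(t : (size v).-tuple bool) (-1) ^+ (size v - size (mask t v)) * g (mask t v) = altsum g v.
Proof.
rewrite (sum_tuple _ (fun s => (-1) ^+ (size v - size (mask s v)) * g (mask s v))).
rewrite /altsum big_seq [RHS]big_seq; apply: eq_bigr => s; rewrite mem_bitseqs => /eqP e.
by rewrite size_mask // -e -(count_predC id s) addKn.
Qed.

Lemma filter_mask s (w : seq nat) : uniq w -> size s = size w ->
  [seq j <- w | j \notin mask (map negb s) w] = mask s w.
Proof.
elim: s w => [|c s IH] [|j w] //= /andP[jw Uw] [sw].
have jm u : j \notin mask u w by apply: contra jw; apply: mem_mask.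
have e : [seq i <- w | i \notin j :: mask (map negb s) w] = [seq i <- w | i \notin mask (map negb s) w].
  by apply/eq_in_filter => i iw; rewrite inE (_ : i == j = false) //; apply: contraNF jw => /eqP<-.
by case: c => /=; rewrite ?jm ?mem_head /= ?e IH.
Qed.

Theorem cpoly_dpoly w : is_perm w -> avoids w [:: 1; 4; 2; 3]%N -> cpoly w = dpoly w.
Proof.
move=> pw av; have Uw : uniq w by rewrite (perm_uniq pw) iota_uniq.
set m := size w in pw *.
rewrite /cpoly (signed_sum (fun v => Upsilon (std v))) /altsum.
pose D (P : {set 'I_m * 'I_m} * {set 'I_m * 'I_m}) s :=
  all (removable P.1 P.2) (mask (map negb s) w).
(* The values deleted by the mask [s] form the set of pipes required to be removable; the sign
   counts them. *)
transitivity (\sum_(s <- bitseqs m) (-1) ^+ count negb s *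
    \sum_(P : {set 'I_m * 'I_m} * {set 'I_m * 'I_m} | MRPD w P.1 P.2 && D P s) beta ^+ #|P.2|).
  rewrite big_seq [RHS]big_seq; apply: eq_bigr => s; rewrite mem_bitseqs => /eqP ss.
  congr (_ * _); pose S := [pred j | j \in mask (map negb s) w].
  rewrite (eq_bigl (fun P : {set 'I_m * 'I_m} * {set 'I_m * 'I_m} => MRPD w P.1 P.2 &&
    all (fun j => S j ==> removable P.1 P.2 j) (pipes m))); last first.
    move=> P; congr (_ && _); apply/allP/allP => h j jm.
      by apply/implyP => Sj; apply: h.
    have jw := mem_mask jm; rewrite (perm_mem pw) in jw.
    by have /implyP := h j jw; apply.
  rewrite sum_MRPD // ssum_pdsum //; [|exact: iota_ltn_sorted|exact: no_1423_avoids].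
  rewrite filter_mask //; apply: Upsilon_std.
    by apply: sorted_filter; [exact: ltn_trans|exact: iota_ltn_sorted].
  by rewrite -(filter_mask Uw ss); apply: perm_filter.
under eq_bigr => s _ do rewrite big_distrr /=.
under eq_bigr => s _ do rewrite big_mkcond /=.
rewrite exchange_big /= /dpoly [RHS]big_mkcond; apply: eq_bigr => P _.
case mr: (MRPD w P.1 P.2) => /=; last by rewrite big1.
rewrite (eq_bigr (fun s => beta ^+ #|P.2| * ((-1) ^+ count negb s * (all (removable P.1 P.2) (mask (map negb s) w))%:R))).
  rewrite -big_distrr /= altsum_all.
  have -> : all (predC (removable P.1 P.2)) w = core P.1 P.2 by rewrite (perm_all _ pw).
  by case: (core _ _); rewrite ?mulr1 ?mulr0.
by move=> s _; rewrite /D; case: (all _ _); rewrite ?mulr1 ?mulr0 // mulrC.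
Qed.

Theorem theorem3p9 (w : seq nat) :
  is_perm w -> avoids w [:: 1; 4; 2; 3]%N ->
  cpoly w = dpoly w /\
  Upsilon w = \sum_(t : (size w).-tuple bool) dpoly (std (mask t w)).
Proof.
move=> pw av; split; first exact: cpoly_dpoly.
have Uw : uniq w by rewrite (perm_uniq pw) iota_uniq.
(* Inversion applies to [Upsilon] composed with [std]; each alternating sum over a subword is then
   the [cpoly] of its standardization, to which the first identity applies. *)
rewrite -[in LHS](std_id pw) -(sum_altsum (fun v => Upsilon (std v))) -sum_tuple.
apply: eq_bigr => t _; have Um : uniq (mask t w) by apply: mask_uniq.
rewrite -cpoly_dpoly ?std_is_perm //; last exact: avoids_std_mask.
rewrite /cpoly (signed_sum (fun v => Upsilon (std v))) /altsum size_map.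
by apply: eq_bigr => s _; rewrite std_mask_std.
Qed.
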